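(* Let $d\ge1$ be an integer. For any $1<p,s<\infty$ and $\alpha\in\mathbb{R}$ with $\alpha\le d+1$ and $\frac1s+\frac1p+\frac{\alpha}{d+1}\le 2$, there exists a constant $C$ depending only on $p,\alpha,d,s$ such that $$\left|\int_{\mathbb{B}^d}\int_{\mathbb{B}^d}\frac{f(w)g(z)}{|1-\langle z,w\rangle|^\alpha}\,dv(w)\,dv(z)\right|\le C\,\|f\|_{L^p}\|g\|_{L^s}$$ for all $f\in L^p(\mathbb{B}^d)$ and $g\in L^s(\mathbb{B}^d)$.
   Context: $\mathbb{B}^d$ is the open unit ball of $\mathbb{C}^d$ with Lebesgue measure $dv$ normalized so that $v(\mathbb{B}^d)=1$; $\langle z,w\rangle=\sum_j z_j\overline{w_j}$; $L^p(\mathbb{B}^d)=L^p(\mathbb{B}^d,dv)$. *)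

(* Defs.v *)
From HB Require Import structures.
From mathcomp Require Import all_boot all_order all_algebra.
From mathcomp Require Import complex.
From mathcomp Require Import all_classical all_reals all_analysis.
From mathcomp Require Import measurable_realfun.
From mathcomp Require Import lra.

Set Implicit Arguments.
Unset Strict Implicit.
Unset Printing Implicit Defensive.
Import Order.TTheory GRing.Theory Num.Theory.
Import ComplexField.Normc.
Local Open Scope classical_set_scope.
Local Open Scope ring_scope.
Local Open Scope complex_scope.

Section pushforward_facts.
Context d d' (T : measurableType d) (T' : measurableType d') (R : realType).
Variables (f : T -> T') (mf : measurable_fun setT f).

Variable m : {measure set T -> \bar R}.

Lemma pushforward_measure0 : pushforward m f set0 = 0%E.
Proof. by rewrite /pushforward preimage_set0 measure0. Qed.

Lemma pushforward_measure_ge0 A : (0 <= pushforward m f A)%E.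
Proof. exact: measure_ge0. Qed.

Lemma pushforward_measure_sigma_additive : semi_sigma_additive (pushforward m f).
Proof. exact: measure_semi_sigma_additive. Qed.

End pushforward_facts.

Lemma sigma_finite_pushforward d d' (T : measurableType d)
    (T' : measurableType d') (R : realType) (m : set T -> \bar R)
    (f : T -> T') (g : T' -> T) :
  sigma_finite setT m -> measurable_fun setT g -> cancel f g ->
  sigma_finite setT (pushforward m f).
Proof.
move=> [F FT mF] mg fK.
exists (fun i => g @^-1` F i) => [|i].
  by rewrite -preimage_bigcup -FT preimage_setT.
have [mFi mFioo] := mF i; split.
  by rewrite -[X in measurable X]setTI; exact: mg.
rewrite /pushforward (_ : f @^-1` (g @^-1` F i) = F i)//.
by apply/seteqP; split => x /=; rewrite fK.
Qed.

Lemma sigma_finite_product d1 d2 (T1 : measurableType d1)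
    (T2 : measurableType d2) (R : realType)
    (m1 : {sigma_finite_measure set T1 -> \bar R})
    (m2 : {sigma_finite_measure set T2 -> \bar R}) :
  sigma_finite setT (m1 \x m2)%E.
Proof.
have /sigma_finiteP[F [TF ndF Foo]] := sigma_finiteT m1.
have /sigma_finiteP[G [TG ndG Goo]] := sigma_finiteT m2.
exists (fun n => F n `*` G n) => [|k].
  rewrite -setXTT TF TG predeqE => -[x y]; split.
    move=> [/= [n _ Fnx] [k _ Gky]]; exists (maxn n k) => //; split.
    - by move: x Fnx; exact/subsetPset/ndF/leq_maxl.
    - by move: y Gky; exact/subsetPset/ndG/leq_maxr.
  by move=> [n _ []/= ? ?]; split; exists n.
have [? ?] := Foo k; have [? ?] := Goo k.
split; first exact: measurableX.
by rewrite product_measure1E// lte_mul_pinfty// ge0_fin_numE.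
Qed.


Section complex_measurable.
Variable R : realType.

Definition mkC (p : measurableTypeR R * measurableTypeR R) : R[i] :=
  p.1 +i* p.2.

(* since mkC is a bijection, this is the Borel sigma-algebra of R x R
   transported to C *)
Definition measurableC_sets : set (set R[i]) :=
  [set A | measurable (mkC @^-1` A)].

Let measurableC0 : measurableC_sets set0.
Proof. by rewrite /measurableC_sets /= preimage_set0. Qed.

Let measurableCC A : measurableC_sets A -> measurableC_sets (~` A).
Proof. by move=> mA; exact: (measurableC mA). Qed.

Let measurableC_bigcup (F : (set R[i])^nat) :
  (forall i, measurableC_sets (F i)) -> measurableC_sets (\bigcup_i F i).
Proof.
move=> mF; rewrite /measurableC_sets /= preimage_bigcup.
by apply: bigcup_measurable => i _; exact: mF.
Qed.

HB.instance Definition _ := isPointed.Build R[i] 0.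
HB.instance Definition _ := @isMeasurable.Build default_measure_display R[i]
  measurableC_sets measurableC0 measurableCC measurableC_bigcup.

Lemma measurable_mkC : measurable_fun setT mkC.
Proof. by move=> _ A mA; rewrite setTI. Qed.

Lemma measurable_Re :
  measurable_fun setT (@complex.Re R : R[i] -> measurableTypeR R).
Proof.
move=> _ A mA; rewrite setTI.
have : measurable_fun setT (fst : measurableTypeR R * measurableTypeR R -> _).
  exact: measurable_fst.
by move=> /(_ measurableT A mA); rewrite setTI.
Qed.

Lemma measurable_Im :
  measurable_fun setT (@complex.Im R : R[i] -> measurableTypeR R).
Proof.
move=> _ A mA; rewrite setTI.
have : measurable_fun setT (snd : measurableTypeR R * measurableTypeR R -> _).
  exact: measurable_snd.
by move=> /(_ measurableT A mA); rewrite setTI.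
Qed.

Lemma measurable_normc : measurable_fun setT (@normc R : R[i] -> R).
Proof.
have -> : @normc R = fun z => Num.sqrt (complex.Re z ^+ 2 + complex.Im z ^+ 2).
  by apply/funext => -[].
apply: (@measurableT_comp _ _ _ _ _ _ (@Num.sqrt R)).
  apply: continuous_measurable_fun. exact: sqrt_continuous.
by apply: measurable_funD; apply: measurable_funX;
  [exact: measurable_Re|exact: measurable_Im].
Qed.

Definition lebC : set R[i] -> \bar R :=
  pushforward (@lebesgue_measure R \x @lebesgue_measure R)%E mkC.

Let lebC0 : lebC set0 = 0%E.
Proof. exact: pushforward_measure0. Qed.

Let lebC_ge0 A : (0 <= lebC A)%E.
Proof. exact: (pushforward_measure_ge0 measurable_mkC). Qed.

Let lebC_sigma_additive : semi_sigma_additive lebC.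
Proof. exact: (pushforward_measure_sigma_additive measurable_mkC). Qed.

HB.instance Definition _ := isMeasure.Build _ _ _ lebC
  lebC0 lebC_ge0 lebC_sigma_additive.

Let sigma_finite_lebC : sigma_finite setT lebC.
Proof.
apply: (sigma_finite_pushforward
  (g := fun z : R[i] => (complex.Re z : measurableTypeR R,
    complex.Im z : measurableTypeR R))) => [||[]//].
  exact: sigma_finite_product.
by apply/measurable_fun_pairP; split; [exact: measurable_Re|exact: measurable_Im].
Qed.

HB.instance Definition _ := Measure_isSigmaFinite.Build _ _ _ lebC
  sigma_finite_lebC.

End complex_measurable.

Section lebesgue_Cn.
Variable R : realType.

Definition consC n (p : R[i] * n.-tuple R[i]) : n.+1.-tuple R[i] :=
  [tuple of p.1 :: p.2].

Lemma measurable_consC n : measurable_fun setT (@consC n).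
Proof. exact: measurable_cons. Qed.

Definition lebC_cons n (m : {sigma_finite_measure set (n.-tuple R[i]) -> \bar R})
    : set (n.+1.-tuple R[i]) -> \bar R :=
  pushforward (@lebC R \x m)%E (@consC n).

Section lebC_cons_measure.
Variables (n : nat) (m : {sigma_finite_measure set (n.-tuple R[i]) -> \bar R}).

Let lebC_cons0 : lebC_cons m set0 = 0%E.
Proof. exact: pushforward_measure0. Qed.

Let lebC_cons_ge0 A : (0 <= lebC_cons m A)%E.
Proof. exact: (pushforward_measure_ge0 (@measurable_consC n)). Qed.

Let lebC_cons_sigma_additive : semi_sigma_additive (lebC_cons m).
Proof. exact: (pushforward_measure_sigma_additive (@measurable_consC n)). Qed.

HB.instance Definition _ := isMeasure.Build _ _ _ (lebC_cons m)
  lebC_cons0 lebC_cons_ge0 lebC_cons_sigma_additive.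

Let sigma_finite_lebC_cons : sigma_finite setT (lebC_cons m).
Proof.
apply: (sigma_finite_pushforward
  (g := fun t : n.+1.-tuple R[i] => (tnth t ord0, [tuple of behead t]))).
- exact: sigma_finite_product.
- apply/measurable_fun_pairP; split; first exact: measurable_tnth.
  exact: measurable_behead.
- by move=> [z t]; congr pair => //; exact/val_inj.
Qed.

HB.instance Definition _ := Measure_isSigmaFinite.Build _ _ _ (lebC_cons m)
  sigma_finite_lebC_cons.

End lebC_cons_measure.

(* C^n is n.-tuple R[i]; the base case is the unit mass at the only point of
   C^0 *)
Fixpoint lebCn n : {sigma_finite_measure set (n.-tuple R[i]) -> \bar R} :=
  if n is n'.+1 then lebC_cons (lebCn n') else \d_[tuple].

Lemma measurable_boxC n (A : set R[i]) : measurable A ->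
  measurable [set z : n.-tuple R[i] | forall j, A (tnth z j)].
Proof.
move=> mA; rewrite (_ : [set z | _] =
    \bigcap_(j in [set: 'I_n]) ((fun z : n.-tuple R[i] => tnth z j) @^-1` A)).
  apply: fin_bigcap_measurable => // j _.
  by rewrite -[X in measurable X]setTI; exact: measurable_tnth.
by apply/seteqP; split => z /= h j; [move=> _|]; exact: h.
Qed.

Lemma lebCn_box n (A : set R[i]) : measurable A ->
  lebCn n [set z | forall j, A (tnth z j)] = (lebC A ^+ n)%E.
Proof.
move=> mA; elim: n => [|n ih].
  by rewrite /= diracE mem_set// => -[].
rewrite [LHS](_ : _ =
    (@lebC R \x lebCn n)%E (A `*` [set z | forall j, A (tnth z j)])).
  rewrite product_measure1E//; last exact: measurable_boxC.
  by rewrite ih expeS.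
rewrite /= /lebC_cons /pushforward; congr (_ _).
apply/seteqP; split => -[z t]/=.
  move=> h; split => [|j]; first exact: (h ord0).
  by have := h (lift ord0 j); rewrite tnthS.
by move=> [h0 h] j; case: (unliftP ord0 j) => [k|] ->; rewrite ?tnthS.
Qed.

Lemma lebC_square (c : R) : 0 < c ->
  lebC [set z : R[i] | `|complex.Re z| < c /\ `|complex.Im z| < c] =
  ((c *+ 2) ^+ 2)%:E.
Proof.
move=> c0; rewrite /lebC /pushforward.
rewrite (_ : _ @^-1` _ = `]-c, c[%classic `*` `]-c, c[%classic); last first.
  by apply/seteqP; split => -[x y] /=; rewrite !in_itv/= !ltr_norml.
rewrite product_measure1E//=; rewrite !lebesgue_measure_itv/= !lte_fin.
by rewrite gtrN// -EFinB -EFinM opprK -mulr2n expr2.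
Qed.

End lebesgue_Cn.

Section unit_ball.
Variables (R : realType) (d : nat).

Definition unit_ball : set (d.-tuple R[i]) :=
  [set z | \sum_(j < d) normc (tnth z j) ^+ 2 < 1].

Lemma measurable_unit_ball : measurable unit_ball.
Proof.
pose N2 (z : d.-tuple R[i]) := \sum_(j < d) normc (tnth z j) ^+ 2.
have mN2 : measurable_fun setT N2.
  apply: measurable_sum => j; apply: measurable_funX.
  by apply: measurableT_comp; [exact: measurable_normc|exact: measurable_tnth].
rewrite (_ : unit_ball = setT `&` N2 @^-1` `]-oo, 1[%classic).
  exact: mN2.
by rewrite setTI; apply/seteqP; split => z /=; rewrite in_itv.
Qed.

Let square (c : R) : set R[i] :=
  [set z : R[i] | `|complex.Re z| < c /\ `|complex.Im z| < c].

Let measurable_square c : measurable (square c).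
Proof.
rewrite (_ : square c =
    (@complex.Re R : R[i] -> measurableTypeR R) @^-1` `]-c, c[%classic `&`
    (@complex.Im R : R[i] -> measurableTypeR R) @^-1` `]-c, c[%classic).
  apply: measurableI; rewrite -[X in measurable X]setTI.
    exact: measurable_Re.
  exact: measurable_Im.
by apply/seteqP; split => z; rewrite /square/= !in_itv/= !ltr_norml.
Qed.

Let sqr_normcE (z : R[i]) : normc z ^+ 2 = complex.Re z ^+ 2 + complex.Im z ^+ 2.
Proof. by case: z => x y; rewrite sqr_sqrtr// addr_ge0 ?sqr_ge0. Qed.

Lemma lebCn_unit_ball_lty : (lebCn R d unit_ball < +oo)%E.
Proof.
have : (lebCn R d [set z | forall j, square 1 (tnth z j)] < +oo)%E.
  by rewrite lebCn_box// lebC_square// -EFin_expe ltry.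
apply: le_lt_trans; apply: le_measure; rewrite ?inE.
- exact: measurable_unit_ball.
- exact: measurable_boxC.
move=> z zB j.
have : normc (tnth z j) ^+ 2 < 1.
  apply: le_lt_trans zB; rewrite (bigD1 j)//= lerDl.
  by apply: sumr_ge0 => i _; exact: sqr_ge0.
rewrite sqr_normcE => h; rewrite /square/=.
split; rewrite -(@ltr_pXn2r _ 2)// ?nnegrE// real_normK ?num_real// expr1n.
  by apply: le_lt_trans h; rewrite lerDl sqr_ge0.
by apply: le_lt_trans h; rewrite lerDr sqr_ge0.
Qed.

Lemma lebCn_unit_ball_gt0 : (0 < lebCn R d unit_ball)%E.
Proof.
pose c : R := (d.+1%:R *+ 2)^-1.
have c0 : 0 < c by rewrite invr_gt0.
have : (0 < lebCn R d [set z | forall j, square c (tnth z j)])%E.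
  by rewrite lebCn_box// lebC_square// -EFin_expe lte_fin !exprn_gt0// pmulrn_lgt0.
move=> /lt_le_trans; apply; apply: le_measure; rewrite ?inE.
- exact: measurable_boxC.
- exact: measurable_unit_ball.
move=> z zc; rewrite /unit_ball/=.
have c1 : c ^+ 2 *+ 2 <= d.+1%:R^-1.
  have x0 : 0 < d.+1%:R^-1 :> R by rewrite invr_gt0.
  have x1 : d.+1%:R^-1 <= 1 :> R by rewrite invf_le1 ?ler1n.
  have -> : c = d.+1%:R^-1 / 2 by rewrite /c -[_ *+ 2]mulr_natr invfM.
  by move: x0 x1; move: (d.+1%:R^-1 : R) => x x0 x1; nra.
apply: (@le_lt_trans _ _ (\sum_(j < d) d.+1%:R^-1)).
  apply: ler_sum => j _; apply: le_trans c1.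
  have [/ltW hx /ltW hy] := zc j.
  by rewrite sqr_normcE mulr2n lerD// -[leLHS]real_normK ?num_real//
    ler_pXn2r ?nnegrE ?(ltW c0).
by rewrite sumr_const card_ord -[ltLHS]mulr_natl ltr_pdivrMr// mul1r ltr_nat.
Qed.

Lemma unit_ball_scale_ge0 : 0 <= (fine (lebCn R d unit_ball))^-1.
Proof. by rewrite invr_ge0 fine_ge0. Qed.

(* The normalized measure dv of the ball, as a measure on C^d that vanishes
   outside of the ball. fine and ^-1 lose nothing here: see
   lebCn_unit_ball_gt0, lebCn_unit_ball_lty and ball_measure_unit_ball. *)
Definition ball_measure : set (d.-tuple R[i]) -> \bar R :=
  mscale (NngNum unit_ball_scale_ge0)
    (mrestr (lebCn R d) measurable_unit_ball).

HB.instance Definition _ := Measure.on ball_measure.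

Lemma ball_measureT : ball_measure setT = 1%E.
Proof.
rewrite /ball_measure /mscale/= /mrestr setTI.
have fB : lebCn R d unit_ball \is a fin_num.
  by rewrite ge0_fin_numE// lebCn_unit_ball_lty.
rewrite -[X in (_ * X)%E]fineK// -EFinM mulVf// gt_eqF//.
by rewrite fine_gt0// lebCn_unit_ball_gt0 lebCn_unit_ball_lty.
Qed.

HB.instance Definition _ := Measure_isProbability.Build _ _ _ ball_measure
  ball_measureT.

Lemma ball_measure_unit_ball : ball_measure unit_ball = 1%E.
Proof.
by rewrite -ball_measureT /ball_measure /mscale/= /mrestr setIid setTI.
Qed.

End unit_ball.
Arguments unit_ball : clear implicits.
Arguments ball_measure : clear implicits.

Definition inner_Cn (R : realType) d (z w : d.-tuple R[i]) : R[i] :=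
  \sum_(j < d) tnth z j * (tnth w j)^*.

Definition Cintegral dT (T : measurableType dT) (R : realType)
    (mu : {measure set T -> \bar R}) (D : set T) (f : T -> R[i]) : R[i] :=
  Rintegral mu D (fun x => complex.Re (f x)) +i*
  Rintegral mu D (fun x => complex.Im (f x)).

Section Lp_ball.
Variables (R : realType) (d : nat).

Definition Lp_norm (p : R) (f : d.-tuple R[i] -> R[i]) : \bar R :=
  'N[ball_measure R d]_(p%:E)[(fun z => (normc (f z))%:E) \_ (unit_ball R d)].

(* A function on the ball is represented by a total function on C^d, whose
   values outside of the ball play no role. *)
Definition mem_Lp (p : R) (f : d.-tuple R[i] -> R[i]) : Prop :=
  measurable_fun (unit_ball R d) f /\ (Lp_norm p f < +oo)%E.

Lemma Lp_normE (p : R) (f : d.-tuple R[i] -> R[i]) : 0 < p ->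
  Lp_norm p f =
  ((\int[ball_measure R d]_(z in unit_ball R d) (normc (f z) `^ p)%:E)
     `^ p^-1)%E.
Proof.
move=> p0; rewrite /Lp_norm unlock; congr (_ `^ _)%E.
rewrite [RHS]integral_mkcond; apply: eq_integral => z _.
rewrite !patchE; case: ifPn => _ /=.
  by rewrite ger0_norm//; case: (f z) => x y; exact: sqrtr_ge0.
by rewrite normr0 powR0// gt_eqF.
Qed.

End Lp_ball.

(* Main.v *)
(** Put [rho z w = |1 - <z, w>|], [u z = 1 - |z|^2] and [N = rho^-(d+1)]. From
    [2 Re (1 - <z, w>) = u z + u w + |z - w|^2], the points [w] of the ball with
    [rho z w < r] lie within [sqrt (2 r)] of [z]; slicing along a real coordinate
    of [w] that is bounded away from 0 shows that those with also [u w < delta]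
    have measure [O(r^d delta)], without using the unitary invariance of the
    measure.  Two dyadic summations then give the Forelli-Rudin estimate
    [int u(w)^-t N(z, w) dv(w) <= K u(z)^-t] for [0 < t < 1].

    Since the measure is finite and [rho <= 2], one may lower [p] and raise
    [alpha] until [alpha = (d+1) (P + S)] with [P = 1 - 1/p], [S = 1 - 1/s] and
    [P + S <= 1].  Then [f(w) g(z) N^(P+S)] is the product of the powers
    [1 - P - S], [S] and [P] of [f(w)^p g(z)^s],
    [f(w)^p N (u(w)/u(z))^(P/2)] and [g(z)^s N (u(z)/u(w))^(S/2)], hence at most
    their sum, and each of the three terms integrates to a constant when
    [f] and [g] are normalized (an off-diagonal Schur test). *)

Require Import Defs.
From mathcomp Require Import all_boot all_order all_algebra.
From mathcomp Require Import complex.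
From mathcomp Require Import all_classical all_reals all_analysis.
From mathcomp Require Import measurable_realfun.
From mathcomp Require Import ring lra.
Import Order.TTheory GRing.Theory Num.Theory.
Import ComplexField.Normc.
Local Open Scope classical_set_scope.
Local Open Scope ring_scope.
Local Open Scope complex_scope.

(** * Domination and geometric sums for integrals of nonnegative functions *)

Section integral_lemmas.
Set Implicit Arguments.
Unset Strict Implicit.
Context d (T : measurableType d) (R : realType).
Variable mu : {measure set T -> \bar R}.
Implicit Types (D : set T) (f g : T -> \bar R).
Local Open Scope ereal_scope.

(* Unlike ge0_le_integral, no measurability: the integral of a nonnegative
   function is a supremum over the simple functions below it. *)
Lemma ge0_le_integral_nonmeas D f g :
  (forall x, D x -> 0 <= f x) -> (forall x, D x -> f x <= g x) ->
  \int[mu]_(x in D) f x <= \int[mu]_(x in D) g x.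
Proof.
move=> f0 fg.
rewrite !ge0_integralE//; last first.
  by move=> x Dx; apply: le_trans (fg _ Dx); exact: f0.
apply: le_ereal_sup => _ [h/= hf <-]; exists h => // x.
apply: (le_trans (hf x)); apply: lee_restrict => //.
Qed.

Lemma ge0_le_integral_cst_setI D (S : set T) f (a b : R) :
  measurable D -> measurable S -> (0 <= b)%R ->
  (forall x, D x -> 0 <= f x) -> (forall x, D x -> ~ S x -> f x = 0) ->
  (forall x, D x -> f x <= b%:E) -> mu S <= a%:E ->
  \int[mu]_(x in D) f x <= (a * b)%:E.
Proof.
move=> mD mS b0 f0 fS fb mSa.
apply: (@le_trans _ _ (\int[mu]_(x in D) (b%:E * (\1_S x)%:E))).
  apply: ge0_le_integral_nonmeas => // x Dx.
  rewrite indicE; have [xS|xS] := boolP (x \in S); first by rewrite mule1 fb.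
  by rewrite mule0 fS// => Sx; move: xS; rewrite mem_set.
rewrite ge0_integralZl//; last first.
  by apply: measurableT_comp => //; exact: measurable_indic.
rewrite integral_indic// EFinM muleC; apply: lee_pmul => //.
apply: le_trans mSa; apply: le_measure; rewrite ?inE//; exact: measurableI.
Qed.

(** Serves both dyadic summations. [f] is dominated by the series of the functions [c k * g] cut off
    to [E k], whose integrals are bounded by a geometric series; overlaps of the [E k] only enlarge
    the dominating series. *)
Lemma ge0_integral_cover_geometric D (E : (set T)^nat) f g
    (c m : R^nat) (K q : R) :
  measurable D -> (forall k, measurable (E k)) -> (forall k, E k `<=` D) ->
  measurable_fun D g -> (forall x, D x -> 0 <= f x) ->
  (forall x, D x -> 0 <= g x) -> (forall k, 0 <= c k)%R ->
  (forall x, D x -> exists2 k, E k x & f x <= (c k)%:E * g x) ->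
  (forall k, \int[mu]_(x in E k) g x <= (m k)%:E) ->
  (forall k, c k * m k <= K * q ^+ k)%R -> (0 <= q < 1)%R ->
  \int[mu]_(x in D) f x <= (K / (1 - q))%:E.
Proof.
move=> mD mE ED mg f0 g0 c0 fcg gm cm /andP[q0 q1].
pose h k x := (c k)%:E * (g \_ (E k)) x.
have h0 k x : D x -> 0 <= h k x.
  move=> Dx; apply: mule_ge0; first by rewrite lee_fin.
  by rewrite patchE; case: ifP => // _; exact: g0.
have mgE k : measurable_fun D (g \_ (E k)).
  apply: (measurable_restrict g (mE k) mD).1; rewrite (setIidr (ED k)).
  exact: measurable_funS mg.
have mh k : measurable_fun D (h k) by exact: measurable_funeM.
apply: (@le_trans _ _ (\int[mu]_(x in D) (\sum_(k <oo) h k x))).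
  apply: ge0_le_integral_nonmeas => // x Dx.
  have [k Ekx /le_trans] := fcg x Dx; apply.
  apply: (@le_trans _ _ (\sum_(0 <= i < k.+1) h i x)).
    rewrite big_nat_recr//= {2}/h patchE mem_set// leeDr//.
    by apply: sume_ge0 => i _; exact: h0.
  by apply: nneseries_lim_ge => i _ _; exact: h0.
rewrite integral_nneseries//.
have intE k : \int[mu]_(x in D) h k x <= (K * q ^+ k)%:E.
  rewrite ge0_integralZl//; last 2 first.
  - by move=> x Dx; rewrite patchE; case: ifP => // _; exact: g0.
  - by rewrite lee_fin.
  rewrite integral_mkcond -patch_setI (setIidr (ED k)) -integral_mkcond.
  apply: (@le_trans _ _ ((c k)%:E * (m k)%:E)); last by rewrite -EFinM lee_fin.
  by apply: lee_wpmul2l; [rewrite lee_fin|exact: gm].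
apply: (@le_trans _ _ (\sum_(k <oo) (K * q ^+ k)%:E)).
  by apply: lee_nneseries => // k _ _; apply: integral_ge0 => x; exact: h0.
have := @cvg_geometric_series R K q; rewrite ger0_norm// => /(_ q1) cv.
suff -> : \sum_(k <oo) (K * q ^+ k)%:E = (K / (1 - q))%:E by [].
apply: cvg_lim => //.
rewrite [X in X @ _ --> _](_ : _ = EFin \o series (geometric K q)).
  by apply: cvg_EFin; [exact: nearW|exact: cv].
by apply/funext => n; rewrite /= /series/= sumEFin.
Qed.
End integral_lemmas.

(** * Product measures bounded through their sections *)

Section product_measure_bounds.
Set Implicit Arguments.
Unset Strict Implicit.
Context d1 d2 (T1 : measurableType d1) (T2 : measurableType d2) (R : realType).
Variable m1 : {sigma_finite_measure set T1 -> \bar R}.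
Variable m2 : {sigma_finite_measure set T2 -> \bar R}.
Implicit Types E : set (T1 * T2).

Lemma product_measure_xsection_le E (S : set T1) (a b : R) : 0 <= b ->
  measurable S -> (forall x, E x -> S x.1) ->
  (m1 S <= a%:E)%E -> (forall x, (m2 (xsection E x) <= b%:E)%E) ->
  ((m1 \x m2) E <= (a * b)%:E)%E.
Proof.
move=> b0 mS ES mSa Eb.
apply: (ge0_le_integral_cst_setI _ mS) => //= x _ nSx.
suff -> : xsection E x = set0 by rewrite measure0.
rewrite -subset0 => y; rewrite /xsection/= inE => /ES; exact: nSx.
Qed.

Lemma product_measure_ysection_le E (S : set T2) (a b : R) : 0 <= b ->
  measurable E -> measurable S -> (forall x, E x -> S x.2) ->
  (m2 S <= a%:E)%E -> (forall y, (m1 (ysection E y) <= b%:E)%E) ->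
  ((m1 \x m2) E <= (a * b)%:E)%E.
Proof.
move=> b0 mE mS ES mSa Eb.
(* By uniqueness, the product measure is also obtained by integrating the measures of the
   [y]-sections. *)
rewrite (_ : _ E = (m1 \x^ m2)%E E); last first.
  by apply: product_measure_unique => // A B mA mB; exact: product_measure2E.
apply: (ge0_le_integral_cst_setI _ mS) => //= y _ nSy.
suff -> : ysection E y = set0 by rewrite measure0.
rewrite -subset0 => x; rewrite /ysection/= inE => /ES; exact: nSy.
Qed.

End product_measure_bounds.

(** * Lebesgue measure of thin sets in the line and in the complex plane *)

Section lebesgue_diameter.
Set Implicit Arguments.
Unset Strict Implicit.
Variable R : realType.
Implicit Types E : set (measurableTypeR R).

Lemma subset_itv_diam E (l : R) : 0 <= l ->
  (forall x y, E x -> E y -> `|x - y| <= l) ->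
  exists a, E `<=` `[a - l, a + l]%classic.
Proof.
move=> l0 El; have [->|/set0P[a Ea]] := eqVneq E set0; first by exists 0 => x.
by exists a => x Ex; rewrite /= in_itv/= -ler_distl; exact: El.
Qed.

Lemma lebesgue_measure_itv_pm (a l : R) : 0 <= l ->
  lebesgue_measure (`[a - l, a + l]%classic : set (measurableTypeR R)) =
  (2 * l)%:E.
Proof.
move=> l0; rewrite lebesgue_measure_itv/= lte_fin.
case: ltP => h; last by congr EFin; lra.
by rewrite -EFinB; congr EFin; lra.
Qed.

Lemma lebesgue_measure_diam_le E (l : R) : 0 <= l -> measurable E ->
  (forall x y, E x -> E y -> `|x - y| <= l) ->
  (lebesgue_measure E <= (2 * l)%:E)%E.
Proof.
move=> l0 mE /(subset_itv_diam l0)[a Ea].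
by rewrite -(lebesgue_measure_itv_pm a l0); apply: le_measure; rewrite ?inE.
Qed.

(** On each half-line [|x + y| = |x| + |y| >= 2 * c], so factoring [x ^+ 2 - y ^+ 2] bounds the
    diameter of that half of [E] by [dl / (2 * c)]. *)
Lemma lebesgue_measure_sqr_diam_le E (c dl : R) : 0 < c -> 0 <= dl ->
  measurable E -> (forall x, E x -> c <= `|x|) ->
  (forall x y, E x -> E y -> `|x ^+ 2 - y ^+ 2| <= dl) ->
  (lebesgue_measure E <= (2 * dl / c)%:E)%E.
Proof.
move=> c0 d0 mE Ec Ed.
have mp : measurable (`[0, +oo[%classic : set (measurableTypeR R)) by [].
have mn : measurable (`]-oo, 0[%classic : set (measurableTypeR R)) by [].
have key x y : E x -> E y -> 0 <= x * y -> `|x - y| <= dl / (2 * c).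
  move=> Ex Ey xy; have := Ed _ _ Ex Ey; have := Ec _ Ex; have := Ec _ Ey.
  rewrite subr_sqr normrM => cy cx; rewrite ler_pdivlMr ?mulr_gt0//.
  apply: le_trans; apply: ler_wpM2l => //.
  have : `|x + y| ^+ 2 = (`|x| + `|y|) ^+ 2.
    by rewrite real_normK ?num_real// !sqrrD -normrM ger0_norm// !real_normK ?num_real.
  move/eqP; rewrite eqrXn2 ?addr_ge0//.
  move/eqP => ->; lra.
rewrite (_ : E = (E `&` `[0, +oo[) `|` (E `&` `]-oo, 0[)); last first.
  rewrite -setIUr; apply/esym/setIidl => x _ /=; rewrite !in_itv/= andbT.
  by case: leP; [left|right].
apply: (le_trans (measureU2 _ _ _)); try exact: measurableI.
have -> : 2 * dl / c = 2 * (dl / (2 * c)) + 2 * (dl / (2 * c)).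
  by field; rewrite gt_eqF.
have h0 : 0 <= dl / (2 * c) by rewrite divr_ge0// mulr_ge0// ltW.
rewrite EFinD; apply: leeD; apply: lebesgue_measure_diam_le => //;
  try exact: measurableI.
- move=> x y [Ex /=]; rewrite in_itv/= andbT => x0 [Ey /=]; rewrite in_itv/= andbT => y0.
  by apply: key => //; exact: mulr_ge0.
- move=> x y [Ex /=]; rewrite in_itv/= => x0 [Ey /=]; rewrite in_itv/= => y0.
  by apply: key => //; rewrite mulr_le0// ltW.
Qed.

(** A boolean index lets [~~ b] name the other real coordinate, so that one statement covers both
    slicing directions. *)
Definition part (b : bool) (z : R[i]) : R :=
  if b then complex.Re z else complex.Im z.

Lemma measurable_part b : measurable_fun setT (part b : R[i] -> measurableTypeR R).
Proof. by case: b; [exact: measurable_Re|exact: measurable_Im]. Qed.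

(** The coordinate [part (~~ b)] stays in an interval of length [2 * l], and each slice where it is
    fixed falls under [lebesgue_measure_sqr_diam_le]. *)
Lemma lebC_slice_le (b : bool) (E : set R[i]) (c dl l : R) :
  0 < c -> 0 <= dl -> 0 <= l -> measurable E ->
  (forall z, E z -> c <= `|part b z|) ->
  (forall z w, E z -> E w -> `|part (~~ b) z - part (~~ b) w| <= l) ->
  (forall z w, E z -> E w -> part (~~ b) z = part (~~ b) w ->
    `|part b z ^+ 2 - part b w ^+ 2| <= dl) ->
  (lebC E <= (2 * l * (2 * dl / c))%:E)%E.
Proof.
move=> c0 dl0 l0 mE Ec El Ed.
have b0 : 0 <= 2 * dl / c by rewrite divr_ge0 ?mulr_ge0// ltW.
have [a Ea] : exists a, (part (~~ b)) @` E `<=` `[a - l, a + l]%classic.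
  apply: subset_itv_diam => // _ _ [z Ez <-] [w Ew <-]; exact: El.
have S0 : (lebesgue_measure (`[(a - l)%R, (a + l)%R]%classic : set (measurableTypeR R))
    <= (2 * l)%:E)%E by rewrite lebesgue_measure_itv_pm.
have mE' : measurable (@mkC R @^-1` E) by exact: mE.
case: b Ec El Ed Ea => /= Ec El Ed Ea; rewrite /lebC /pushforward.
  apply: (@product_measure_ysection_le _ _ _ _ _ lebesgue_measure
    lebesgue_measure _ `[a - l, a + l]%classic) => //.
  - by move=> [x y] /= Exy; apply: Ea; exists (mkC (x, y)).
  - move=> y; apply: lebesgue_measure_sqr_diam_le => //.
    + exact: measurable_ysection.
    + by move=> x; rewrite /ysection/= inE => /Ec.
    + by move=> x x'; rewrite /ysection/= !inE => h /(Ed _ _ h) /=; exact.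
apply: (@product_measure_xsection_le _ _ _ _ _ lebesgue_measure
    lebesgue_measure _ `[a - l, a + l]%classic) => //.
- by move=> [x y] /= Exy; apply: Ea; exists (mkC (x, y)).
- move=> x; apply: lebesgue_measure_sqr_diam_le => //.
  + exact: measurable_xsection.
  + by move=> y; rewrite /xsection/= inE => /Ec.
  + by move=> y y'; rewrite /xsection/= !inE => h /(Ed _ _ h) /=; exact.
Qed.

End lebesgue_diameter.

(** * Slicing the measure of [C^n] along one complex coordinate *)

Section lebCn_slices.
Set Implicit Arguments.
Unset Strict Implicit.
Variable R : realType.
Local Notation C := R[i].

Definition square_at (a : C) (L : R) : set C :=
  [set z | forall b, `|part b z - part b a| <= L].

Lemma square_atE (a : C) L : square_at a L =
  (part true) @^-1` `[part true a - L, part true a + L]%classic `&`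
  (part false) @^-1` `[part false a - L, part false a + L]%classic.
Proof.
apply/seteqP; split => z /=; rewrite !in_itv/= -!ler_distl.
  by move=> h; split; [exact: (h true)|exact: (h false)].
by move=> [h1 h2] [].
Qed.

Lemma measurable_square_at (a : C) L : measurable (square_at a L).
Proof.
rewrite square_atE; apply: measurableI.
  by rewrite -[X in measurable X]setTI; exact: (measurable_part true).
by rewrite -[X in measurable X]setTI; exact: (measurable_part false).
Qed.

Lemma lebC_square_at (a : C) L : 0 <= L ->
  lebC (square_at a L) = ((2 * L) ^+ 2)%:E.
Proof.
move=> L0; rewrite square_atE /lebC /pushforward.
rewrite (_ : _ @^-1` _ = `[part true a - L, part true a + L]%classic `*`
  `[part false a - L, part false a + L]%classic)//.
by rewrite product_measure1E//= !lebesgue_measure_itv_pm.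
Qed.

Definition polysquare_at n (z : n.-tuple C) (L : R) : set (n.-tuple C) :=
  [set w | forall k b, `|part b (tnth w k) - part b (tnth z k)| <= L].

Lemma measurable_polysquare_at n (z : n.-tuple C) L :
  measurable (polysquare_at z L).
Proof.
rewrite (_ : polysquare_at z L = \bigcap_(j in [set: 'I_n])
    ((fun w : n.-tuple C => tnth w j) @^-1` square_at (tnth z j) L)).
  apply: fin_bigcap_measurable => // j _.
  rewrite -[X in measurable X]setTI; apply: measurable_tnth => //.
  exact: measurable_square_at.
by apply/seteqP; split => w /= h j; [move=> _|]; exact: h.
Qed.

Lemma lebCn_polysquare_at n (z : n.-tuple C) L : 0 <= L ->
  lebCn R n (polysquare_at z L) = (((2 * L) ^+ 2) ^+ n)%:E.
Proof.
move=> L0; elim: n z => [|n ih] z.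
  by rewrite /= diracE mem_set// => -[].
rewrite [LHS](_ : _ = (@lebC R \x lebCn R n)%E
   (square_at (tnth z ord0) L `*` polysquare_at [tuple of behead z] L)).
  rewrite product_measure1E//; last exact: measurable_polysquare_at.
    by rewrite ih [_ ^+ n.+1]exprS EFinM -(lebC_square_at (tnth z ord0) L0).
  exact: measurable_square_at.
rewrite /= /lebC_cons /pushforward; congr (_ _).
have zE k : tnth z (lift ord0 k) = tnth [tuple of behead z] k.
  by rewrite tnth_behead; congr tnth; apply: val_inj; rewrite /= inordK// ltnS.
apply/seteqP; split => -[x t]/=.
  move=> h; split => [|k] b; first exact: (h ord0).
  by have := h (lift ord0 k) b; rewrite tnthS zE.
move=> [h0 h] k b; case: (unliftP ord0 k) => [i|] ->; last exact: h0.
rewrite tnthS zE; exact: h.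
Qed.

Definition update n (w : n.-tuple C) (j : 'I_n) (z : C) : n.-tuple C :=
  [tuple if i == j then z else tnth w i | i < n].

Lemma tnth_update n (w : n.-tuple C) j z i :
  tnth (update w j z) i = if i == j then z else tnth w i.
Proof. by rewrite tnth_mktuple. Qed.

Lemma update_consC0 n (t : n.-tuple C) x z :
  update (consC (x, t)) ord0 z = consC (z, t).
Proof.
apply: eq_from_tnth => i; rewrite tnth_update.
by case: (unliftP ord0 i) => [k|] -> //=; rewrite !tnthS.
Qed.

Lemma update_consCS n (t : n.-tuple C) x z k :
  update (consC (x, t)) (lift ord0 k) z = consC (x, update t k z).
Proof.
apply: eq_from_tnth => i; rewrite tnth_update.
case: (unliftP ord0 i) => [l|] -> //=; rewrite !tnthS tnth_update.
by rewrite (inj_eq (@lift_inj _ _)).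
Qed.

(** Around any point of [E], the [n] coordinates other than [j] stay in a polysquare of measure
    [((2 * L) ^+ 2) ^+ n], and over each of its points the slice has measure at most [A]. *)
Lemma lebCn_slice_le n (j : 'I_n.+1) (E : set (n.+1.-tuple C)) (L A : R) :
  0 <= L -> 0 <= A -> measurable E ->
  (forall w w', E w -> E w' ->
     forall k b, `|part b (tnth w k) - part b (tnth w' k)| <= L) ->
  (forall w, (lebC [set z | E (update w j z)] <= A%:E)%E) ->
  (lebCn R n.+1 E <= (((2 * L) ^+ 2) ^+ n * A)%:E)%E.
Proof.
move=> L0 A0; elim: n j E => [|n ih] j E mE EL EA;
  have [->|/set0P[w0 Ew0]] := eqVneq E set0;
  rewrite ?measure0 ?lee_fin ?mulr_ge0 ?exprn_ge0 ?mulr_ge0//.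
  have mE' : measurable (@consC R 0 @^-1` E).
    by rewrite -[X in measurable X]setTI; exact: measurable_consC.
  rewrite [leLHS]/= /lebC_cons /pushforward (ord1 j) in EA *.
  apply: (@product_measure_ysection_le _ _ _ _ _ (@lebC R) (lebCn R 0) _ setT) => //.
    by rewrite /= diracT.
  move=> t; apply: le_trans (EA (consC (0, t))).
  rewrite le_eqVlt; apply/orP; left; apply/eqP; congr (lebC _).
  by apply/seteqP; split => z; rewrite /ysection/= inE update_consC0.
have mE' : measurable (@consC R n.+1 @^-1` E).
  by rewrite -[X in measurable X]setTI; exact: measurable_consC.
(* If [j] is not the first coordinate, the first one lies in a square around that of [w0] and
   induction treats the sections. If it is, the [y]-sections are the slices themselves. *)
case: (unliftP ord0 j) => [k|] jE; rewrite {}jE in EA *.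
  rewrite [_ ^+ n.+1]exprS -mulrA [leLHS]/= /lebC_cons /pushforward.
  apply: (@product_measure_xsection_le _ _ _ _ _ (@lebC R) (lebCn R n.+1) _
    (square_at (tnth w0 ord0) L)) => //.
  - by rewrite mulr_ge0 ?exprn_ge0 ?mulr_ge0.
  - exact: measurable_square_at.
  - by move=> [z t] Ezt b; exact: (EL _ _ Ezt Ew0 ord0).
  - by rewrite -(lebC_square_at (tnth w0 ord0) L0).
  - move=> x; rewrite [X in lebCn R n.+1 X](_ : _ = [set t | E (consC (x, t))]); last first.
      by apply/seteqP; split => z; rewrite /xsection/= inE.
    apply: (ih k).
    + rewrite (_ : [set t | _] = xsection (@consC R n.+1 @^-1` E) x).
        exact: measurable_xsection.
      by apply/seteqP; split => z; rewrite /xsection/= inE.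
    + by move=> w w' Ew Ew' i b; have := EL _ _ Ew Ew' (lift ord0 i) b; rewrite !tnthS.
    + move=> w; apply: le_trans (EA (consC (x, w))).
      rewrite le_eqVlt; apply/orP; left; apply/eqP; congr (lebC _).
      by apply/seteqP; split => z /=; rewrite update_consCS.
rewrite [leLHS]/= /lebC_cons /pushforward.
apply: (@product_measure_ysection_le _ _ _ _ _ (@lebC R) (lebCn R n.+1) _
    (polysquare_at [tuple of behead w0] L)) => //.
- exact: measurable_polysquare_at.
- move=> [z t] Ezt k b.
  have := EL _ _ Ezt Ew0 (lift ord0 k) b; rewrite tnthS tnth_behead.
  by rewrite (_ : inord _ = lift ord0 k)//; apply: val_inj; rewrite /= inordK// ltnS.
- by rewrite lebCn_polysquare_at.
- move=> t; apply: le_trans (EA (consC (0, t))).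
  rewrite le_eqVlt; apply/orP; left; apply/eqP; congr (lebC _).
  by apply/seteqP; split => z; rewrite /ysection/= inE update_consC0.
Qed.
End lebCn_slices.

(** * Geometry of the ball: the defect and [|1 - <z, w>|] *)

Section ball_geometry.
Set Implicit Arguments.
Unset Strict Implicit.
Variable R : realType.
Local Notation C := R[i].

Lemma sqr_normcE (z : C) : normc z ^+ 2 = part true z ^+ 2 + part false z ^+ 2.
Proof. by case: z => x y; rewrite sqr_sqrtr// addr_ge0 ?sqr_ge0. Qed.

Lemma normc_ge0 (z : C) : 0 <= normc z.
Proof. by case: z => x y; exact: sqrtr_ge0. Qed.

Lemma partB b (z w : C) : part b (z - w) = part b z - part b w.
Proof. by case: b z w => -[x y] [x' y']. Qed.

Lemma norm_part_le b (z : C) : `|part b z| <= normc z.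
Proof.
rewrite -(@ler_pXn2r _ 2)// ?nnegrE ?normc_ge0// real_normK ?num_real//.
by rewrite sqr_normcE; case: b; rewrite ?lerDl ?lerDr sqr_ge0.
Qed.

Lemma normc_le_part (z : C) : normc z <= `|part true z| + `|part false z|.
Proof.
rewrite -(@ler_pXn2r _ 2)// ?nnegrE ?normc_ge0 ?addr_ge0//.
rewrite sqr_normcE sqrrD !real_normK ?num_real//.
by rewrite addrAC lerDl mulrn_wge0// mulr_ge0.
Qed.

Lemma normc_conj (z : C) : normc z^* = normc z.
Proof. by case: z => x y /=; rewrite sqrrN. Qed.

Lemma Re_sum I (s : seq I) (F : I -> C) :
  complex.Re (\sum_(i <- s) F i) = \sum_(i <- s) complex.Re (F i).
Proof. by apply: (big_morph (@complex.Re R)) => // -[x y] []. Qed.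

Lemma Im_sum I (s : seq I) (F : I -> C) :
  complex.Im (\sum_(i <- s) F i) = \sum_(i <- s) complex.Im (F i).
Proof. by apply: (big_morph (@complex.Im R)) => // -[x y] []. Qed.

Variable d : nat.
Local Notation Cd := (d.-tuple C).
Implicit Types z w : Cd.

(** The function [u] of the overview; on the ball it is comparable to the distance to the sphere. *)
Definition defect z : R := 1 - \sum_(j < d) normc (tnth z j) ^+ 2.

Definition rho z w : R := normc (1 - inner_Cn z w).

Lemma defect_gt0 z : unit_ball R d z -> 0 < defect z.
Proof. by rewrite /unit_ball/= /defect subr_gt0. Qed.

(** The left side equals [2 Re (1 - <z, w>)]. Dropping terms from it gives the positivity of [rho],
    its comparison with the defect and the bound on coordinate differences. *)
Lemma rho_ge z w :
  defect z + defect w + \sum_(j < d) normc (tnth w j - tnth z j) ^+ 2 <=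
  2 * rho z w.
Proof.
apply: (@le_trans _ _ (2 * complex.Re (1 - inner_Cn z w))); last first.
  rewrite ler_pM2l//; apply: le_trans (ler_norm _) _.
  exact: (norm_part_le true).
rewrite -[complex.Re _]/(part true _) partB /= /inner_Cn Re_sum mulrBr mulr1.
rewrite /defect [leLHS](_ : _ = 2 - (\sum_(j < d) (normc (tnth z j) ^+ 2 +
   normc (tnth w j) ^+ 2 - normc (tnth w j - tnth z j) ^+ 2))); last first.
  by rewrite sumrB big_split/=; ring.
rewrite lerD2l lerN2 mulr_sumr; apply: ler_sum => j _.
rewrite !sqr_normcE !partB; case: (tnth z j) (tnth w j) => [a b] [a' b'] /=.
by rewrite le_eqVlt; apply/orP; left; apply/eqP; ring.
Qed.

Lemma rho_gt0 z w : unit_ball R d z -> unit_ball R d w -> 0 < rho z w.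
Proof.
move=> /defect_gt0 z0 /defect_gt0 w0; have := rho_ge z w.
have : 0 <= \sum_(j < d) normc (tnth w j - tnth z j) ^+ 2.
  by apply: sumr_ge0 => j _; exact: sqr_ge0.
lra.
Qed.

Lemma defect_le_rho z w : unit_ball R d z -> defect w <= 2 * rho z w.
Proof.
move=> /defect_gt0 z0; have := rho_ge z w.
have : 0 <= \sum_(j < d) normc (tnth w j - tnth z j) ^+ 2.
  by apply: sumr_ge0 => j _; exact: sqr_ge0.
lra.
Qed.

Lemma rhoC z w : rho z w = rho w z.
Proof.
rewrite /rho -[LHS]normc_conj rmorphB rmorph1; congr (normc (1 - _)).
rewrite /inner_Cn raddf_sum; apply: eq_bigr => j _.
case: (tnth z j) (tnth w j) => [a b] [a' b'].
by apply/eqP; rewrite eq_complex /=; apply/andP; split; apply/eqP; ring.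
Qed.

Lemma normc_coord_lt1 w j : unit_ball R d w -> normc (tnth w j) < 1.
Proof.
move=> wB; rewrite -(@ltr_pXn2r _ 2)// ?nnegrE ?normc_ge0// expr1n.
apply: le_lt_trans wB; rewrite (bigD1 j)//= lerDl.
by apply: sumr_ge0 => i _; exact: sqr_ge0.
Qed.

Lemma normc_coordB_le z w j : unit_ball R d z -> unit_ball R d w ->
  normc (tnth w j - tnth z j) <= Num.sqrt (2 * rho z w).
Proof.
move=> zB wB; rewrite -(@ler_pXn2r _ 2)// ?nnegrE ?normc_ge0 ?sqrtr_ge0//.
rewrite sqr_sqrtr; last first.
  by rewrite mulr_ge0// normc_ge0.
apply: le_trans (rho_ge z w).
rewrite (bigD1 j)//= addrCA lerDl addr_ge0//.
  by apply: addr_ge0; exact/ltW/defect_gt0.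
by apply: sumr_ge0 => i _; exact: sqr_ge0.
Qed.

Lemma inner_update z w j x y :
  inner_Cn z (update w j x) - inner_Cn z (update w j y) =
  tnth z j * (x - y)^*.
Proof.
rewrite /inner_Cn -sumrB (bigD1 j)//= !tnth_update eqxx big1 ?addr0.
  by rewrite -mulrBr rmorphB.
by move=> i ij; rewrite !tnth_update (negbTE ij) subrr.
Qed.

(** Along a slice the inner product moves by [z_j] times the conjugate of [x - y]. When [z_j] is
    away from 0, a slice of the set [rho < r] thus has diameter of order [r], better than the order
    [sqrt r] of [normc_coordB_le]. *)
Lemma rho_update z w j x y : normc (tnth z j) * normc (x - y) <=
  rho z (update w j x) + rho z (update w j y).
Proof.
rewrite -[normc (x - y)]normc_conj -normcM -(inner_update z w).
rewrite (_ : _ - _ = (1 - inner_Cn z (update w j y)) +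
  - (1 - inner_Cn z (update w j x))); last by ring.
by apply: le_trans (le_normcD _ _) _; rewrite normcN addrC.
Qed.

Lemma defect_update w j x y :
  defect (update w j x) - defect (update w j y) = normc y ^+ 2 - normc x ^+ 2.
Proof.
have dB (a b : R) : (1 - a) - (1 - b) = b - a by ring.
rewrite /defect dB -sumrB (bigD1 j)//=.
rewrite !tnth_update eqxx big1 ?addr0// => i ij.
by rewrite !tnth_update (negbTE ij) subrr.
Qed.

End ball_geometry.

(** * Measurability of the defect and of [rho] *)

Section measurability.
Set Implicit Arguments.
Unset Strict Implicit.
Variables (R : realType) (d : nat).
Local Notation Cd := (d.-tuple R[i]).

Lemma measurable_part_tnth dX (X : measurableType dX) (f : X -> Cd) j b :
  measurable_fun setT f ->
  measurable_fun setT (fun x => part b (tnth (f x) j)).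
Proof.
move=> mf; apply: (measurableT_comp (measurable_part b)).
exact: (measurableT_comp (measurable_tnth j) mf).
Qed.

Lemma measurable_defect : measurable_fun setT (@defect R d).
Proof.
apply: measurable_funB => //; apply: measurable_sum => j.
apply: measurable_funX; apply: measurableT_comp; first exact: measurable_normc.
exact: measurable_tnth.
Qed.

Lemma measurable_rho_comp dX (X : measurableType dX) (f g : X -> Cd) :
  measurable_fun setT f -> measurable_fun setT g ->
  measurable_fun setT (fun x => rho (f x) (g x)).
Proof.
move=> mf mg.
(* In real coordinates [rho] is the square root of a polynomial. *)
rewrite (_ : (fun x => _) = fun x => Num.sqrt (
  (1 - \sum_(j < d) (part true (tnth (f x) j) * part true (tnth (g x) j) +
    part false (tnth (f x) j) * part false (tnth (g x) j))) ^+ 2 +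
  (\sum_(j < d) (part true (tnth (f x) j) * part false (tnth (g x) j) -
    part false (tnth (f x) j) * part true (tnth (g x) j))) ^+ 2)).
  apply: (@measurableT_comp _ _ _ _ _ _ (@Num.sqrt R)).
    by apply: continuous_measurable_fun; exact: sqrt_continuous.
  apply: measurable_funD; apply: measurable_funX.
    apply: measurable_funB => //; apply: measurable_sum => j.
    by apply: measurable_funD; apply: measurable_funM; exact: measurable_part_tnth.
  apply: measurable_sum => j.
  by apply: measurable_funB; apply: measurable_funM; exact: measurable_part_tnth.
apply/funext => x; rewrite -[LHS]ger0_norm ?normc_ge0// -sqrtr_sqr sqr_normcE.
congr Num.sqrt; congr (_ ^+ 2 + _ ^+ 2).
  rewrite partB; congr (_ - _); rewrite /= /inner_Cn Re_sum.
  apply: eq_bigr => j _.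
  by case: (tnth (f x) j) (tnth (g x) j) => [a b] [a' b'] /=; ring.
rewrite partB /= /inner_Cn Im_sum sub0r -sumrN.
apply: eq_bigr => j _.
by case: (tnth (f x) j) (tnth (g x) j) => [a b] [a' b'] /=; ring.
Qed.

Lemma measurable_rho z : measurable_fun setT (@rho R d z).
Proof. exact: measurable_rho_comp. Qed.

Lemma measurable_lt dX (X : measurableType dX) (f : X -> R) (c : R) :
  measurable_fun setT f -> measurable [set x | f x < c].
Proof.
move=> mf; rewrite -[X in measurable X]setTI.
rewrite (_ : [set x | f x < c] = f @^-1` `]-oo, c[%classic).
  exact: mf.
by apply/seteqP; split => x /=; rewrite in_itv.
Qed.

Lemma measurable_ge dX (X : measurableType dX) (f : X -> R) (c : R) :
  measurable_fun setT f -> measurable [set x | c <= f x].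
Proof.
move=> mf; rewrite -[X in measurable X]setTI.
rewrite (_ : [set x | c <= f x] = f @^-1` `[c, +oo[%classic).
  exact: mf.
by apply/seteqP; split => x /=; rewrite in_itv/= andbT.
Qed.

End measurability.

(** * Measure of Carleson boxes *)

Section carleson_box.
Set Implicit Arguments.
Unset Strict Implicit.
Variables (R : realType) (n : nat).
Local Notation d := n.+1.
Local Notation C := R[i].
Local Notation Cd := (d.-tuple C).
Local Notation ball := (unit_ball R d).

Lemma ball_measure_le (E : set Cd) (a : R) : measurable E ->
  (lebCn R d E <= a%:E)%E ->
  (ball_measure R d E <= ((fine (lebCn R d ball))^-1 * a)%:E)%E.
Proof.
move=> mE Ea; rewrite /ball_measure /mscale/= EFinM.
apply: lee_wpmul2l; first by rewrite lee_fin invr_ge0 fine_ge0.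
apply: le_trans Ea; rewrite /mrestr; apply: le_measure; rewrite ?inE//.
by apply: measurableI => //; exact: measurable_unit_ball.
Qed.

(** A Carleson box whose extent [r] around [z] and depth [dl] below the sphere are independent. *)
Definition box (z : Cd) (r dl : R) : set Cd :=
  [set w | [/\ ball w, rho z w < r & defect w < dl]].

Lemma measurable_box z r dl : measurable (box z r dl).
Proof.
rewrite (_ : box z r dl = ball `&` [set w | rho z w < r] `&`
  [set w | defect w < dl]).
  apply: measurableI; last by apply: measurable_lt; exact: measurable_defect.
  apply: measurableI; first exact: measurable_unit_ball.
  by apply: measurable_lt; exact: measurable_rho.
by apply/seteqP; split => w /=; [case|move=> [[]]].
Qed.

(** Chosen so that [2 * d * c ^+ 2 = c <= 1/2]: a point with [|w|^2 > 1/2] has a real coordinate of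
    size at least [c]. *)
Let c : R := (2 * d%:R)^-1.

Let c_gt0 : 0 < c. Proof. by rewrite invr_gt0 mulr_gt0. Qed.

Let c_le : c <= 2^-1.
Proof. by rewrite lef_pV2 ?posrE ?mulr_gt0// ler_pMr// ler1n. Qed.

Definition box_piece z r dl j b : set Cd :=
  box z r dl `&` [set w | c <= `|part b (tnth w j)|].

Lemma measurable_box_piece z r dl j b : measurable (box_piece z r dl j b).
Proof.
apply: measurableI; first exact: measurable_box.
apply: measurable_ge; apply: measurableT_comp => //.
exact: measurable_part_tnth.
Qed.

(* Either z j stays away from 0, since w j is close to z j, or r is bounded
   from below. *)
Let slice_diam z r dl j b w x y : ball z -> 0 < r ->
  box_piece z r dl j b (update w j x) -> box_piece z r dl j b (update w j y) ->
  normc (x - y) <= 16 * r / c ^+ 2.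
Proof.
move=> zB r0 [[xB xr _] xc] [[yB yr _] yc].
have c2 : 0 < c ^+ 2 by rewrite exprn_gt0.
(* Above this threshold [16 * r / c ^+ 2] is at least 2, the diameter of the unit disc; below it
   [sqrt (2 * r) <= c / 2], which leaves [|z_j| >= c / 2]. *)
have [rc|rc] := leP (c ^+ 2 / 8) r.
  have := normc_coord_lt1 j xB; have := normc_coord_lt1 j yB.
  rewrite !tnth_update eqxx => y1 x1.
  apply: (@le_trans _ _ 2); last by rewrite ler_pdivlMr//; lra.
  by apply: le_trans (le_normcD _ _) _; rewrite normcN; lra.
have zj : c / 2 <= normc (tnth z j).
  have := normc_coordB_le j zB xB.
  have : Num.sqrt (2 * rho z (update w j x)) <= c / 2.
    rewrite -(@ler_pXn2r _ 2)// ?nnegrE ?sqrtr_ge0 ?divr_ge0 ?ltW//.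
    rewrite sqr_sqrtr ?mulr_ge0 ?normc_ge0// expr_div_n.
    have -> : (2 : R) ^+ 2 = 4 by ring.
    by move: xr rc; lra.
  have := norm_part_le b (tnth (update w j x) j - tnth z j).
  have := norm_part_le b (tnth z j).
  move: xc; rewrite partB /=.
  have := ler_normD (part b (tnth (update w j x) j) - part b (tnth z j)) (part b (tnth z j)).
  rewrite subrK; lra.
have := rho_update z w j x y.
have h : c / 2 * normc (x - y) <= normc (tnth z j) * normc (x - y).
  by rewrite ler_wpM2r// normc_ge0.
have : c / 2 * (16 * r / c ^+ 2) = 8 * r / c by field; rewrite gt_eqF.
have : 4 * r <= 8 * r / c.
  rewrite ler_pdivlMr//; have rc0 : 0 <= r * (2^-1 - c).
    by rewrite mulr_ge0 ?(ltW r0)// subr_ge0.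
  lra.
move=> h1 h2 h3.
rewrite -(ler_pM2l (_ : 0 < c / 2)) ?divr_gt0// h2; lra.
Qed.

(** Each of the [n] coordinates other than [j] contributes [32 * r], the square of
    [4 * sqrt (2 * r)]. In coordinate [j], one real direction contributes a multiple of [r] by
    [slice_diam] and the other a multiple of [dl], because the defect is confined to []0, dl[]. *)
Lemma box_piece_le z r dl j b : ball z -> 0 < r -> 0 < dl ->
  (lebCn R d (box_piece z r dl j b) <=
   (32 ^+ n * (64 / c ^+ 3) * r ^+ d * dl)%:E)%E.
Proof.
move=> zB r0 dl0.
have rE : (2 * (2 * Num.sqrt (2 * r))) ^+ 2 = 32 * r.
  by rewrite !exprMn sqr_sqrtr ?mulr_ge0 ?ltW//; ring.
pose A := 2 * (16 * r / c ^+ 2) * (2 * dl / c).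
rewrite [leRHS](_ : _ = (((2 * (2 * Num.sqrt (2 * r))) ^+ 2) ^+ n * A)%:E); last first.
  rewrite rE exprMn /A (exprS r n); congr EFin.
  by field; rewrite gt_eqF.
have l0 : 0 <= 16 * r / c ^+ 2 by rewrite divr_ge0 ?mulr_ge0 ?exprn_ge0 ?ltW.
have d0 : 0 <= 2 * dl / c by rewrite divr_ge0 ?mulr_ge0 ?ltW.
apply: (@lebCn_slice_le _ _ j).
- by rewrite mulr_ge0// sqrtr_ge0.
- by rewrite /A mulr_ge0// mulr_ge0.
- exact: measurable_box_piece.
- move=> w w' [[wB wr _] _] [[w'B w'r _] _] k b'.
  have sq v : ball v -> rho z v < r ->
      `|part b' (tnth v k) - part b' (tnth z k)| <= Num.sqrt (2 * r).
    move=> vB vr; rewrite -partB; apply: le_trans (norm_part_le _ _) _.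
    apply: le_trans (normc_coordB_le k zB vB) _.
    by apply: ler_wsqrtr; rewrite ler_pM2l// ltW.
  have := sq _ wB wr; have := sq _ w'B w'r.
  set a := part _ _; set a' := part _ _; set a'' := part _ _ => h1 h2.
  rewrite (_ : _ - _ = (a'' - a') - (a - a')); last by rewrite /a /a''; ring.
  by apply: le_trans (ler_normB _ _) _; lra.
- move=> w; apply: (@lebC_slice_le _ b).
  + exact: c_gt0.
  + exact: ltW.
  + exact: l0.
  + rewrite -[X in measurable X]setTI.
    have mu : measurable_fun setT (fun x : C => update w j x).
      apply/measurable_fun_tnthP => i.
      have E0 : (fun x : C => tnth (update w j x) i) =
          (fun x => if i == j then x else tnth w i).
        by apply/funext => x; rewrite tnth_update.
      suff : measurable_fun setT (fun x : C => tnth (update w j x) i) by [].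
      by rewrite E0; case: (i == j); [exact: measurable_id|exact: measurable_cst].
    by apply: mu => //; exact: measurable_box_piece.
  + by move=> x [_] /=; rewrite tnth_update eqxx.
  + move=> x y Ex Ey; rewrite -partB; apply: le_trans (norm_part_le _ _) _.
    exact: slice_diam Ex Ey.
  (* With the other real part fixed, the difference of the squares of [part b] is, up to sign, a
     difference of two defects, both between 0 and [dl]. *)
  + move=> x y [[xB _ xd] _] [[yB _ yd] _] xy.
    have /= := defect_update w j x y.
    have xg := defect_gt0 xB; have yg := defect_gt0 yB.
    rewrite (_ : normc y ^+ 2 - normc x ^+ 2 = part b y ^+ 2 - part b x ^+ 2).
      by move=> h; rewrite ler_norml; apply/andP; split; lra.
    by rewrite !sqr_normcE; case: (b) xy => /= ->; ring.
Qed.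

(** Otherwise [|w|^2 <= 1/2], so the defect of [w] is at least [1/2]; but it is smaller than [dl],
    and smaller than [2 * r] by [defect_le_rho]. *)
Let box_big_coord z r dl w : ball z -> box z r dl w ->
  (r <= 4^-1 \/ dl <= 2^-1) -> exists j b, c <= `|part b (tnth w j)|.
Proof.
move=> zB [wB wr wd] rd; apply: contrapT => h.
have {}h j b : `|part b (tnth w j)| < c.
  by rewrite ltNge; apply/negP => jb; apply: h; exists j, b.
have sq j b : part b (tnth w j) ^+ 2 <= c ^+ 2.
  rewrite -[leLHS]real_normK ?num_real//.
  by apply: lerXn2r; rewrite ?nnegrE ?(ltW c_gt0)//; exact: ltW.
have : \sum_(j < d) normc (tnth w j) ^+ 2 <= 2^-1.
  apply: (@le_trans _ _ (\sum_(j < d) 2 * c ^+ 2)).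
    apply: ler_sum => j _; rewrite sqr_normcE.
    by have := sq j true; have := sq j false; lra.
  rewrite sumr_const card_ord -[leLHS]mulr_natr.
  have -> : 2 * c ^+ 2 * d%:R = c by rewrite /c; field.
  exact: c_le.
have := defect_le_rho w zB; move: wr wd; rewrite /defect.
case: rd; lra.
Qed.

Theorem ball_measure_box_le : exists2 K : R, 0 < K &
  forall z r dl, ball z -> 0 < r -> 0 < dl ->
  (ball_measure R d (box z r dl) <= (K * r ^+ d * dl)%:E)%E.
Proof.
pose k := (fine (lebCn R d ball))^-1.
have k0 : 0 <= k by rewrite invr_ge0 fine_ge0.
pose K1 := 32 ^+ n * (64 / c ^+ 3).
have K10 : 0 < K1 by rewrite mulr_gt0 ?exprn_gt0// divr_gt0// exprn_gt0.
have K20 : 0 <= k * (d.*2%:R * K1) by rewrite mulr_ge0// mulr_ge0// ltW.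
exists (k * (d.*2%:R * K1) + 2 * 4 ^+ d).
  by rewrite ltr_wpDl// mulr_gt0// exprn_gt0.
move=> z r dl zB r0 dl0.
(* For such a large box the total mass 1 is already below [(4 * r) ^+ d * (2 * dl)], whence the
   summand [2 * 4 ^+ d] of the constant. *)
have [/andP[r4 d2]|rd] := boolP ((4^-1 < r) && (2^-1 < dl)).
  apply: (@le_trans _ _ 1%E).
    by apply: probability_le1; exact: measurable_box.
  have h4 : 1 <= (4 * r) ^+ d by apply: exprn_ege1; lra.
  have -> : (k * (d.*2%:R * K1) + 2 * 4 ^+ d) * r ^+ d * dl =
      k * (d.*2%:R * K1) * (r ^+ d * dl) + (4 * r) ^+ d * (2 * dl).
    by rewrite exprMn; ring.
  rewrite lee_fin ler_wpDl//.
    by apply: mulr_ge0 => //; rewrite mulr_ge0 ?exprn_ge0// ltW.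
  by rewrite -[leLHS]mulr1; apply: ler_pM => //; lra.
(* The [2 d] real coordinates are numbered by [i]: half of [i] is the complex coordinate, its parity
   selects the real part (odd) or the imaginary part (even). *)
pose A i := box_piece z r dl (inord i./2) (odd i).
apply: (@le_trans _ _ (k * (d.*2%:R * K1) * r ^+ d * dl)%:E); last first.
  rewrite lee_fin; apply: ler_wpM2r; first exact: ltW.
  apply: ler_wpM2r; first by rewrite exprn_ge0// ltW.
  by rewrite lerDl mulr_ge0// exprn_ge0.
rewrite -!(mulrA k); apply: ball_measure_le; first exact: measurable_box.
apply: (@le_trans _ _ (\sum_(i < d.*2) lebCn R d (A i))%E).
  apply: content_subadditive => [i _||w Ew].
  - exact: measurable_box_piece.
  - exact: measurable_box.
  - rewrite -bigcup_mkord.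
    have [j [b jb]] : exists j b, c <= `|part b (tnth w j)|.
      apply: box_big_coord Ew _ => //.
      by move: rd; rewrite negb_and -!leNgt => /orP.
    exists (b + j.*2)%N => /=.
      by case: (b); rewrite ?add0n ?add1n ?ltn_double ?ltn_Sdouble.
    split => //=; rewrite half_bit_double oddD odd_double addbF oddb.
    by rewrite inord_val.
apply: (@le_trans _ _ (\sum_(i < d.*2) (K1 * r ^+ d * dl)%:E)%E).
  by apply: lee_sum => i _; exact: box_piece_le.
rewrite sumEFin lee_fin sumr_const card_ord -[leLHS]mulr_natl.
by rewrite !mulrA.
Qed.

End carleson_box.

(** * Dyadic scales and real powers *)

Section dyadic.
Set Implicit Arguments.
Unset Strict Implicit.
Variable R : realType.
Implicit Types a b x s t : R.

Lemma lt_mul_exp2 a x : 0 < a -> exists k, x < a * 2 ^+ k.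
Proof.
move=> a0; exists (Num.bound (`|x| / a)).
rewrite mulrC -ltr_pdivrMr//; apply: (@le_lt_trans _ _ (`|x| / a)).
  by rewrite ler_pM2r ?invr_gt0// ler_norm.
have : 0 <= `|x| / a by rewrite divr_ge0// ltW.
move=> /archi_boundP/lt_trans; apply.
by rewrite -natrX ltr_nat ltn_expl.
Qed.

Lemma dyadic_up a x : 0 < a -> a <= x ->
  exists k, a * 2 ^+ k <= x < a * 2 ^+ k.+1.
Proof.
move=> a0 ax; have ex : exists k, x < a * 2 ^+ k by exact: lt_mul_exp2.
case: (ex_minnP ex) => -[|k] xk kmin.
  by move: xk; rewrite expr0 mulr1 ltNge ax.
exists k; rewrite xk andbT leNgt; apply/negP => /kmin.
by rewrite ltnn.
Qed.

Lemma dyadic_down b x : 0 < x -> x < b ->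
  exists k, b * 2^-1 ^+ k.+1 <= x < b * 2^-1 ^+ k.
Proof.
move=> x0 xb; have b0 : 0 < b := lt_trans x0 xb.
have [k] := dyadic_up x0 (ltW xb) => /andP[k1 k2].
have ex : exists k, b * 2^-1 ^+ k <= x.
  exists k.+1; rewrite exprVn ler_pdivrMr ?exprn_gt0//; exact: ltW.
case: (ex_minnP ex) => -[|l] xl lmin.
  by move: xl; rewrite expr0 mulr1 leNgt xb.
exists l; rewrite xl ltNge; apply/negP => /lmin.
by rewrite ltnn.
Qed.

Lemma powRX a n s : 0 <= a -> (a ^+ n) `^ s = (a `^ s) ^+ n.
Proof.
by move=> a0; rewrite -!powR_mulrn ?powR_ge0// powRAC.
Qed.

Lemma ler_powRN a b t : 0 <= t -> 0 < a -> a <= b -> b `^ (- t) <= a `^ (- t).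
Proof.
move=> t0 a0 ab; rewrite !powRN lef_pV2 ?posrE ?powR_gt0//; last exact: lt_le_trans ab.
by rewrite ge0_ler_powR// ?nnegrE ltW//; exact: lt_le_trans ab.
Qed.

(** The ratio of the sum over depths in [integral_cap_le]; this is where [t < 1] matters. *)
Lemma powR_half_lt1 t : t < 1 -> 2^-1 `^ (- t) * 2^-1 < 1 :> R.
Proof.
move=> t1; rewrite ltr_pdivrMr// mul1r -[2^-1]powR_inv1// -powRrM mulrNN mul1r.
rewrite /powR (gt_eqF (_ : 0 < 2))// -[ltRHS](@lnK R) ?posrE// ltr_expR.
by rewrite gtr_pMl// ln_gt0// ltr1n.
Qed.

(** The ratio of the sum over distances in [forelli_rudin]; this is where [0 < t] matters. *)
Lemma powR2N_lt1 t : 0 < t -> 2 `^ (- t) < 1 :> R.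
Proof.
move=> t0; rewrite powRN invf_lt1 ?powR_gt0//.
rewrite -[X in X < _](_ : 1 `^ t = 1); last by rewrite powR1.
by rewrite gt0_ltr_powR// ?nnegrE// ltr1n.
Qed.

End dyadic.

(** * The Forelli-Rudin estimate *)

Section forelli_rudin.
Set Implicit Arguments.
Unset Strict Implicit.
Variables (R : realType) (n : nat).
Local Notation d := n.+1.
Local Notation Cd := (d.-tuple R[i]).
Local Notation ball := (unit_ball R d).
Local Notation mu := (ball_measure R d).

Definition cap (z : Cd) (r : R) : set Cd := ball `&` [set w | rho z w < r].

Lemma measurable_cap z r : measurable (cap z r).
Proof.
apply: measurableI; first exact: measurable_unit_ball.
by apply: measurable_lt; exact: measurable_rho.
Qed.

Lemma measurable_powR_defect (t : R) (D : set Cd) :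
  measurable_fun D (fun w => ((@defect R d w) `^ t)%:E).
Proof.
apply/measurable_EFinP; apply: measurable_funTS.
apply: (measurableT_comp (measurable_powR t)); exact: measurable_defect.
Qed.

Variable t : R.
Hypotheses (t0 : 0 < t) (t1 : t < 1).

Lemma integral_cap_le : exists2 K : R, 0 < K & forall z r, ball z -> 0 < r ->
  (\int[mu]_(w in cap z r) ((defect w) `^ (- t))%:E <=
   (K * (r ^+ d.+1 * r `^ (- t)))%:E)%E.
Proof.
have [K K0 HK] := ball_measure_box_le R n.
pose q : R := 2^-1 `^ (- t) * 2^-1.
have q1 : q < 1 by exact: powR_half_lt1.
exists (2 * K / (1 - q)); first by rewrite divr_gt0 ?subr_gt0// mulr_gt0.
move=> z r zB r0.
pose dl k : R := 2 * r * 2^-1 ^+ k.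
rewrite (_ : _ * _ = (2 * K * (r ^+ d.+1 * r `^ (- t))) / (1 - q)); last by ring.
apply: (@ge0_integral_cover_geometric _ _ _ _ _ (fun k => box z r (dl k)) _
  (cst 1%E) (fun k => (r * 2^-1 ^+ k) `^ (- t))
  (fun k => K * r ^+ d * dl k)).
- exact: measurable_cap.
- by move=> k; exact: measurable_box.
- by move=> k w [].
- exact: measurable_cst.
- by move=> w _; rewrite lee_fin powR_ge0.
- by move=> w _.
- by move=> k; rewrite powR_ge0.
- move=> w [wB wr]; have w0 := defect_gt0 wB.
  have [|k /andP[k1 k2]] := @dyadic_down R (2 * r) (defect w) w0.
    by apply: le_lt_trans (defect_le_rho w zB) _; rewrite ltr_pM2l.
  exists k; first by split.
  rewrite mule1 lee_fin; apply: ler_powRN; first exact: ltW.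
    by rewrite mulr_gt0// exprn_gt0// invr_gt0.
  by apply: le_trans k1; rewrite exprS le_eqVlt; apply/orP; left; apply/eqP; field.
- move=> k; rewrite integral_cst; last exact: measurable_box.
  rewrite mul1e; apply: HK => //.
  by rewrite !mulr_gt0// exprn_gt0// invr_gt0.
- move=> k; rewrite powRM ?exprn_ge0 ?invr_ge0 ?(ltW r0)// powRX ?invr_ge0//.
  rewrite /q /dl exprMn le_eqVlt; apply/orP; left; apply/eqP.
  by rewrite [r ^+ d.+1]exprS; ring.
- by rewrite q1 andbT mulr_ge0 ?powR_ge0.
Qed.

Theorem forelli_rudin : exists2 K : R, 0 < K & forall z, ball z ->
  (\int[mu]_(w in ball) ((defect w) `^ (- t) * (rho z w ^+ d.+1)^-1)%:E <=
   (K * (defect z) `^ (- t))%:E)%E.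
Proof.
have [K K0 HK] := integral_cap_le.
pose q : R := 2 `^ (- t).
have q1 : q < 1 by exact: powR2N_lt1.
exists (K * 2 ^+ d.+1 / (1 - q)).
  by rewrite divr_gt0 ?subr_gt0// mulr_gt0// exprn_gt0.
move=> z zB; have z0 := defect_gt0 zB; set e := defect z in z0 *.
have p2 k : 0 < 2 ^+ k :> R by rewrite exprn_gt0.
have ek k : 0 < e * 2 ^+ k by rewrite mulr_gt0.
rewrite (_ : _ * _ = (K * 2 ^+ d.+1 * e `^ (- t)) / (1 - q)); last by ring.
apply: (@ge0_integral_cover_geometric _ _ _ _ _ (fun k => cap z (e * 2 ^+ k)) _
  (fun w => (defect w `^ (- t))%:E) (fun k => ((e / 2 * 2 ^+ k) ^+ d.+1)^-1)
  (fun k => K * ((e * 2 ^+ k) ^+ d.+1 * (e * 2 ^+ k) `^ (- t)))).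
- exact: measurable_unit_ball.
- by move=> k; exact: measurable_cap.
- by move=> k w [].
- exact: measurable_powR_defect.
- by move=> w _; rewrite lee_fin mulr_ge0 ?powR_ge0// invr_ge0 exprn_ge0// normc_ge0.
- by move=> w _; rewrite lee_fin powR_ge0.
- by move=> k; rewrite invr_ge0 exprn_ge0// mulr_ge0 ?divr_ge0// ltW.
- move=> w wB.
  (* [defect_le_rho] bounds the defect of the second argument, hence the use of symmetry. *)
  have rw : e / 2 <= rho z w.
    by have := defect_le_rho z wB; rewrite rhoC -/e; lra.
  have [|k /andP[k1 k2]] := @dyadic_up R (e / 2) (rho z w) _ rw.
    by rewrite divr_gt0.
  exists k.
    split => //=; apply: lt_le_trans k2 _.
    by rewrite exprS le_eqVlt; apply/orP; left; apply/eqP; field.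
  rewrite -EFinM lee_fin mulrC; apply: ler_wpM2r; first exact: powR_ge0.
  have h : 0 < e / 2 * 2 ^+ k by rewrite mulr_gt0// divr_gt0.
  rewrite lef_pV2 ?posrE ?exprn_gt0//; last exact: lt_le_trans k1.
  by apply: lerXn2r; rewrite ?nnegrE ?(ltW h) ?normc_ge0.
- by move=> k; exact: HK.
- move=> k; rewrite powRM ?(ltW (p2 _)) ?(ltW z0)// powRX//.
  rewrite -/q le_eqVlt; apply/orP; left; apply/eqP.
  rewrite mulrAC expr_div_n invf_div.
  by field; rewrite expf_eq0/= gt_eqF.
- by rewrite q1 andbT powR_ge0.
Qed.

End forelli_rudin.

(** * A Young-type inequality with three factors *)

Section young.
Set Implicit Arguments.
Unset Strict Implicit.
Variable R : realType.
Implicit Types a b x y N P S : R.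

Lemma ler_powR_1D a p q : 0 <= a -> 0 <= p -> p <= q ->
  a `^ p <= 1 + a `^ q.
Proof.
move=> a0 p0 pq; have [a1|a1] := leP a 1.
  rewrite -[leLHS]addr0 lerD ?powR_ge0//.
  rewrite -[leRHS](_ : 1 `^ p = 1); last by rewrite powR1.
  by rewrite ge0_ler_powR// nnegrE.
by rewrite ler_wpDl// ler_powR// ltW.
Qed.

(** Each base is at most [M = x + y + z] and the exponents add up to 1. *)
Lemma powR_mul3_le_sum P S (x y z : R) : 0 <= P -> 0 < S -> P + S <= 1 ->
  0 <= x -> 0 <= y -> 0 <= z ->
  x `^ (1 - (P + S)) * y `^ S * z `^ P <= x + y + z.
Proof.
move=> P0 S0 PS x0 y0 z0; set M := x + y + z.
have M0 : 0 <= M by rewrite !addr_ge0.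
rewrite -[leRHS]powRr1//.
rewrite [X in M `^ X](_ : 1 = 1 - (P + S) + S + P); last by ring.
rewrite [leRHS]powRD; last first.
  by apply/implyP => /eqP h; exfalso; lra.
(* As [M] may be 0, splitting the power requires a nonzero total exponent; here it is [1 - P],
   positive because [0 < S]. *)
rewrite [X in _ <= X * _]powRD; last first.
  by apply/implyP => /eqP h; exfalso; lra.
have l1 : x <= M by rewrite /M; lra.
have l2 : y <= M by rewrite /M; lra.
have l3 : z <= M by rewrite /M; lra.
have e0 : 0 <= 1 - (P + S) by lra.
apply: ler_pM; rewrite ?mulr_ge0 ?powR_ge0//; last first.
  by rewrite ge0_ler_powR// nnegrE.
apply: ler_pM; rewrite ?powR_ge0//; rewrite ge0_ler_powR// ?nnegrE//.
exact: ltW.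
Qed.

(** The three terms are raised to the powers [1 - P - S], [S] and [P]. The exponents of [a] and [b]
    then add up to 1, that of [N] to [P + S], and those of [x] and [y] cancel as
    [P * S / 2 - S * P / 2]. *)
Lemma young_kernel P S a b x y N : 0 < P -> 0 < S -> P + S <= 1 ->
  0 <= a -> 0 <= b -> 0 < x -> 0 < y -> 0 < N ->
  a * b * N `^ (P + S) <=
    a `^ (1 - P)^-1 * b `^ (1 - S)^-1 +
    a `^ (1 - P)^-1 * x `^ (P / 2) * N * y `^ (- (P / 2)) +
    b `^ (1 - S)^-1 * y `^ (S / 2) * N * x `^ (- (S / 2)).
Proof.
move=> P0 S0 PS a0 b0 x0 y0 N0.
apply: le_trans (powR_mul3_le_sum (ltW P0) S0 PS _ _ _); last 3 first.
- by rewrite mulr_ge0 ?powR_ge0.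
- by rewrite !mulr_ge0 ?powR_ge0// ltW.
- by rewrite !mulr_ge0 ?powR_ge0// ltW.
have N0' := ltW N0.
rewrite !powRM ?mulr_ge0 ?powR_ge0//.
rewrite -!powRrM.
set e := 1 - (P + S).
have P1 : 1 - P != 0 by rewrite gt_eqF//; lra.
have S1 : 1 - S != 0 by rewrite gt_eqF//; lra.
have aE : a = a `^ ((1 - P)^-1 * e) * a `^ ((1 - P)^-1 * S).
  have h : (1 - P)^-1 * e + (1 - P)^-1 * S = 1 by rewrite /e; field.
  by rewrite -powRD h ?oner_eq0// powRr1.
have bE : b = b `^ ((1 - S)^-1 * e) * b `^ ((1 - S)^-1 * P).
  have h : (1 - S)^-1 * e + (1 - S)^-1 * P = 1 by rewrite /e; field.
  by rewrite -powRD h ?oner_eq0// powRr1.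
have NE : N `^ (P + S) = N `^ S * N `^ P.
  by rewrite (addrC P) powRD// (gt_eqF N0) implybT.
have xE : x `^ (P / 2 * S) * x `^ (- (S / 2) * P) = 1.
  rewrite -powRD; last by rewrite (gt_eqF x0) implybT.
  by rewrite (_ : _ + _ = 0) ?powRr0//; ring.
have yE : y `^ (- (P / 2) * S) * y `^ (S / 2 * P) = 1.
  rewrite -powRD; last by rewrite (gt_eqF y0) implybT.
  by rewrite (_ : _ + _ = 0) ?powRr0//; ring.
rewrite {1}aE {1}bE NE.
move: (a `^ _) (a `^ _) (b `^ _) (b `^ _) (N `^ _) (N `^ _) xE yE => a1 a2 b1 b2 n1 n2.
move: (x `^ _) (x `^ _) (y `^ _) (y `^ _) => x2 x1 y2 y1 xE yE.
rewrite [leRHS](_ : _ = a1 * a2 * (b1 * b2) * (n1 * n2) * (x1 * x2) * (y1 * y2)).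
  by rewrite xE yE !mulr1 (mulrC a2) (mulrC b2) (mulrC n2).
ring.
Qed.

End young.

(** * Schur-type integrals of the Bergman kernel *)

Section kernel_bound.
Set Implicit Arguments.
Unset Strict Implicit.
Variables (R : realType) (n : nat).
Local Notation d := n.+1.
Local Notation Cd := (d.-tuple R[i]).
Local Notation ball := (unit_ball R d).
Local Notation mu := (ball_measure R d).
Implicit Types F G : Cd -> R.

(** [|<z, w>| <= 1] follows from the arithmetic-geometric mean inequality in each coordinate. *)
Lemma rho_le2 (z w : Cd) : ball z -> ball w -> rho z w <= 2.
Proof.
move=> zB wB; rewrite /rho; apply: le_trans (le_normcD _ _) _.
rewrite normc1 normcN; suff : normc (inner_Cn z w) <= 1 by lra.
pose f j := (normc (tnth z j) ^+ 2 + normc (tnth w j) ^+ 2) / 2.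
apply: (@le_trans _ _ (\sum_(j < d) f j)).
  rewrite /inner_Cn.
  elim/big_ind2 : _ => [|x1 x2 y1 y2 h1 h2|j _]; first by rewrite normc0.
    by apply: le_trans (le_normcD _ _) _; exact: lerD.
  rewrite normcM normc_conj /f ler_pdivlMr// -subr_ge0.
  rewrite [X in 0 <= X](_ : _ = (normc (tnth z j) - normc (tnth w j)) ^+ 2).
    exact: sqr_ge0.
  ring.
rewrite -mulr_suml big_split/= ler_pdivrMr// mul1r.
by have := defect_gt0 zB; have := defect_gt0 wB; rewrite /defect; lra.
Qed.

(** As a factor of the integrand it turns integrals over the ball into integrals over the whole
    space, where Tonelli's theorem is applied. *)
Definition indB (w : Cd) : R := \1_ball w.

Lemma measurable_indB : measurable_fun setT indB.
Proof. by apply: measurable_indic; exact: measurable_unit_ball. Qed.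

Lemma indB_ge0 w : 0 <= indB w.
Proof. by rewrite /indB indicE. Qed.

Lemma indB_in w : ball w -> indB w = 1.
Proof. by move=> wB; rewrite /indB indicE mem_set. Qed.

Lemma indB_out w : ~ ball w -> indB w = 0.
Proof. by move=> wB; rewrite /indB indicE memNset. Qed.

Lemma integral_indB F :
  (\int[mu]_w (indB w * F w)%:E = \int[mu]_(w in ball) (F w)%:E)%E.
Proof.
rewrite [RHS]integral_mkcond; apply: eq_integral => w _.
rewrite patchE; case: ifPn => [|] wB.
  by rewrite indB_in ?mul1r//; exact: set_mem.
by rewrite indB_out ?mul0r// => /mem_set; apply/negP.
Qed.

(** The kernel [N] of the overview, the modulus of the Bergman kernel of the ball. *)
Definition abs_bergman (z w : Cd) : R := (rho z w ^+ d.+1)^-1.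

Lemma abs_bergman_ge0 z w : 0 <= abs_bergman z w.
Proof. by rewrite invr_ge0 exprn_ge0// normc_ge0. Qed.

Lemma abs_bergmanC z w : abs_bergman z w = abs_bergman w z.
Proof. by rewrite /abs_bergman rhoC. Qed.

Lemma measurable_rho_powR dX (X : measurableType dX) (f g : X -> Cd) (a : R) :
  measurable_fun setT f -> measurable_fun setT g ->
  measurable_fun setT (fun x => rho (f x) (g x) `^ a).
Proof.
move=> mf mg; apply: (measurableT_comp (measurable_powR a)).
exact: measurable_rho_comp.
Qed.

Lemma measurable_abs_bergman dX (X : measurableType dX) (f g : X -> Cd) :
  measurable_fun setT f -> measurable_fun setT g ->
  measurable_fun setT (fun x => abs_bergman (f x) (g x)).
Proof.
move=> mf mg; rewrite (_ : (fun x => _) =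
    fun x => rho (f x) (g x) `^ (- d.+1%:R)); first exact: measurable_rho_powR.
by apply/funext => x; rewrite powR_invn// normc_ge0.
Qed.

Definition weight (t : R) (w : Cd) : R := indB w * defect w `^ t.

Lemma weight_ge0 t w : 0 <= weight t w.
Proof. by rewrite mulr_ge0 ?powR_ge0 ?indB_ge0. Qed.

Lemma measurable_weight t : measurable_fun setT (weight t).
Proof.
apply: measurable_funM; first exact: measurable_indB.
apply: (measurableT_comp (measurable_powR t)); exact: measurable_defect.
Qed.

Lemma schur_integral_le (t : R) : 0 < t -> t < 1 ->
  exists2 K : R, 0 < K & forall F, (forall w, 0 <= F w) ->
  measurable_fun setT F ->
  forall M : R, (\int[mu]_(w in ball) (F w)%:E <= M%:E)%E ->
  (\int[mu]_z \int[mu]_w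
     (F z * weight t z * abs_bergman z w * weight (- t) w)%:E <= (K * M)%:E)%E.
Proof.
move=> t0 t1; have [K K0 HK] := forelli_rudin n t0 t1; exists K => //.
move=> F F0 mF M FM.
apply: (@le_trans _ _ (\int[mu]_z (K%:E * (indB z * F z)%:E))%E); last first.
  rewrite ge0_integralZl//; last 3 first.
  - apply/measurable_EFinP; apply: measurable_funM => //.
    exact: measurable_indB.
  - by move=> z _; rewrite lee_fin mulr_ge0 ?indB_ge0.
  - by rewrite lee_fin ltW.
  rewrite integral_indB EFinM; apply: lee_wpmul2l => //.
  by rewrite lee_fin ltW.
have FK0 z : 0 <= F z * weight t z by rewrite mulr_ge0 ?weight_ge0.
apply: ge0_le_integral_nonmeas => z _.
  apply: integral_ge0 => w _.
  by rewrite lee_fin mulr_ge0 ?weight_ge0// mulr_ge0 ?abs_bergman_ge0.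
have [zB|zB] := pselect (ball z); last first.
  rewrite indB_out// mul0r mule0.
  under eq_integral do rewrite /weight (indB_out zB) !mul0r mulr0 !mul0r.
  by rewrite integral0.
under eq_integral do rewrite -mulrA EFinM.
rewrite ge0_integralZl//; last 3 first.
- apply/measurable_EFinP; apply: measurable_funM; last exact: measurable_weight.
  exact: measurable_abs_bergman.
- by move=> w _; rewrite lee_fin mulr_ge0 ?weight_ge0 ?abs_bergman_ge0.
- by rewrite lee_fin.
under eq_integral do rewrite mulrC -mulrA.
rewrite integral_indB.
apply: (le_trans (lee_wpmul2l _ (HK z zB))); first by rewrite lee_fin.
rewrite -!EFinM lee_fin /weight !indB_in// !mul1r.
rewrite [leLHS](_ : _ = K * F z * (defect z `^ t * defect z `^ (- t))); last by ring.
by rewrite powRN mulfV ?mulr1// gt_eqF// powR_gt0// defect_gt0.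
Qed.

End kernel_bound.

(** * The bilinear estimate for nonnegative functions *)

Lemma ge0_le_integral_setT d (T : measurableType d) (R : realType)
    (mu : {measure set T -> \bar R}) (D : set T) (f g : T -> \bar R) :
  (forall x, D x -> (0 <= f x)%E) -> (forall x, (0 <= g x)%E) ->
  (forall x, D x -> (f x <= g x)%E) ->
  (\int[mu]_(x in D) f x <= \int[mu]_x g x)%E.
Proof.
move=> f0 g0 fg; rewrite integral_mkcond; apply: ge0_le_integral_nonmeas => x _.
  by rewrite patchE; case: ifPn => // /set_mem; exact: f0.
by rewrite patchE; case: ifPn => [/set_mem|_]; [exact: fg|exact: g0].
Qed.

Section bilinear_bound.
Set Implicit Arguments.
Unset Strict Implicit.
Variables (R : realType) (n : nat).
Local Notation d := n.+1.
Local Notation Cd := (d.-tuple R[i]).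
Local Notation ball := (unit_ball R d).
Local Notation mu := (ball_measure R d).
Local Notation D := (d.+1%:R : R).
Implicit Types F G : Cd -> R.

Lemma rho_powR_le (alpha beta : R) z w : ball z -> ball w -> alpha <= beta ->
  (rho z w `^ alpha)^-1 <= 2 `^ (beta - alpha) * rho z w `^ (- beta).
Proof.
move=> zB wB ab; have r0 := rho_gt0 zB wB.
rewrite -powRN [leLHS](_ : _ = rho z w `^ ((beta - alpha) - beta)); last first.
  by congr powR; ring.
rewrite [leLHS]powRD ?(gt_eqF r0) ?implybT//; apply: ler_wpM2r; first exact: powR_ge0.
by apply: ge0_ler_powR; rewrite ?nnegrE ?subr_ge0 ?(ltW r0)//; exact: rho_le2.
Qed.

(** [c] and [e] stand for upper bounds of the norms. The normalized integrals are bounded by 2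
    instead of 1 to leave room for lowering the exponent of [F]. *)
Lemma bilinear_bound (P S alpha : R) : 0 < P -> 0 < S -> P + S <= 1 ->
  alpha <= D * (P + S) ->
  exists2 K : R, 0 < K & forall F G,
    (forall w, 0 <= F w) -> (forall z, 0 <= G z) ->
    measurable_fun setT F -> measurable_fun setT G ->
    forall c e, 0 < c -> 0 < e ->
    (\int[mu]_(w in ball) ((F w / c) `^ (1 - P)^-1)%:E <= 2%:E)%E ->
    (\int[mu]_(z in ball) ((G z / e) `^ (1 - S)^-1)%:E <= 2%:E)%E ->
    (\int[mu]_(z in ball) \int[mu]_(w in ball)
       (F w * G z / rho z w `^ alpha)%:E <= (K * c * e)%:E)%E.
Proof.
move=> P0 S0 PS alphaPS.
have P20 : 0 < P / 2 by lra.
have S20 : 0 < S / 2 by lra.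
have P21 : P / 2 < 1 by lra.
have S21 : S / 2 < 1 by lra.
have [K2 K20 H2] := schur_integral_le n P20 P21.
have [K3 K30 H3] := schur_integral_le n S20 S21.
pose k : R := 2 `^ (D * (P + S) - alpha).
have k0 : 0 < k by rewrite powR_gt0.
exists (k * (4 + K2 * 2 + K3 * 2)).
  by rewrite mulr_gt0// !addr_gt0// mulr_gt0.
move=> F G F0 G0 mF mG c e c0 e0 Fc Ge.
pose phi w := (F w / c) `^ (1 - P)^-1.
pose gam z := (G z / e) `^ (1 - S)^-1.
have phi0 w : 0 <= phi w by exact: powR_ge0.
have gam0 z : 0 <= gam z by exact: powR_ge0.
have mphi : measurable_fun setT phi.
  apply: (measurableT_comp (measurable_powR _)).
  exact: measurable_funM.
have mgam : measurable_fun setT gam.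
  apply: (measurableT_comp (measurable_powR _)).
  exact: measurable_funM.
(* The three terms of [young_kernel] at the pair [(z, w)], with [x] and [y] there the defects of [w]
   and [z], cut off to the ball. *)
pose h1 (x : Cd * Cd) := indB x.1 * gam x.1 * (indB x.2 * phi x.2).
pose h2 (x : Cd * Cd) :=
  phi x.2 * weight (P / 2) x.2 * abs_bergman x.2 x.1 * weight (- (P / 2)) x.1.
pose h3 (x : Cd * Cd) :=
  gam x.1 * weight (S / 2) x.1 * abs_bergman x.1 x.2 * weight (- (S / 2)) x.2.
have h10 x : 0 <= h1 x by rewrite !mulr_ge0 ?indB_ge0.
have h20 x : 0 <= h2 x by rewrite mulr_ge0 ?weight_ge0// mulr_ge0 ?abs_bergman_ge0// mulr_ge0 ?weight_ge0.
have h30 x : 0 <= h3 x by rewrite mulr_ge0 ?weight_ge0// mulr_ge0 ?abs_bergman_ge0// mulr_ge0 ?weight_ge0.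
have m1 (f : Cd -> R) : measurable_fun setT f ->
    measurable_fun setT (fun x : Cd * Cd => f x.1).
  by move=> mf; exact: (measurableT_comp mf measurable_fst).
have m2 (f : Cd -> R) : measurable_fun setT f ->
    measurable_fun setT (fun x : Cd * Cd => f x.2).
  by move=> mf; exact: (measurableT_comp mf measurable_snd).
have mh1 : measurable_fun setT h1.
  apply: measurable_funM.
    apply: (m1 (fun z => indB z * gam z)); apply: measurable_funM => //.
    exact: measurable_indB.
  apply: (m2 (fun w => indB w * phi w)); apply: measurable_funM => //.
  exact: measurable_indB.
have mh2 : measurable_fun setT h2.
  apply: measurable_funM; last first.
    by apply: (m1 (weight (- (P / 2)))); exact: measurable_weight.
  apply: measurable_funM; last exact: measurable_abs_bergman.
  apply: measurable_funM; first exact: m2.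
  by apply: (m2 (weight (P / 2))); exact: measurable_weight.
have mh3 : measurable_fun setT h3.
  apply: measurable_funM; last first.
    by apply: (m2 (weight (- (S / 2)))); exact: measurable_weight.
  apply: measurable_funM; last exact: measurable_abs_bergman.
  apply: measurable_funM; first exact: m1.
  by apply: (m1 (weight (S / 2))); exact: measurable_weight.
have kce0 : 0 <= k * c * e by rewrite !mulr_ge0// ltW.
have pw z w : ball z -> ball w -> F w * G z / rho z w `^ alpha <=
    k * c * e * (h1 (z, w) + h2 (z, w) + h3 (z, w)).
  move=> zB wB; have r0 := rho_gt0 zB wB.
  apply: (@le_trans _ _ (F w * G z * (k * rho z w `^ (- (D * (P + S)))))).
    by apply: ler_wpM2l; [rewrite mulr_ge0|exact: rho_powR_le].
  have kE : rho z w `^ (- (D * (P + S))) = abs_bergman z w `^ (P + S).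
    by rewrite /abs_bergman -powR_invn ?(ltW r0)// -powRrM mulNr.
  rewrite kE [leLHS](_ : _ = k * c * e *
    (F w / c * (G z / e) * abs_bergman z w `^ (P + S))); last first.
    by field; rewrite !gt_eqF.
  apply: ler_wpM2l => //.
  have N0 : 0 < abs_bergman z w by rewrite invr_gt0 exprn_gt0.
  have Fc0 : 0 <= F w / c by rewrite divr_ge0// ltW.
  have Ge0 : 0 <= G z / e by rewrite divr_ge0// ltW.
  apply: le_trans (young_kernel P0 S0 PS Fc0 Ge0 (defect_gt0 wB) (defect_gt0 zB) N0) _.
  rewrite /h1 /h2 /h3 /weight /= !indB_in// !mul1r (abs_bergmanC w z).
  by rewrite (mulrC (phi w)).
apply: (@le_trans _ _ (\int[mu]_z \int[mu]_w
    (k * c * e * (h1 (z, w) + h2 (z, w) + h3 (z, w)))%:E)%E).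
  have h0 z w : 0 <= k * c * e * (h1 (z, w) + h2 (z, w) + h3 (z, w)).
    by rewrite mulr_ge0// !addr_ge0.
  have l0 z w : (0 <= (F w * G z / rho z w `^ alpha)%:E)%E.
    by rewrite lee_fin divr_ge0 ?mulr_ge0 ?powR_ge0.
  apply: ge0_le_integral_setT => [z _|z|z zB].
  - by apply: integral_ge0.
  - by apply: integral_ge0 => w _; rewrite lee_fin.
  - apply: ge0_le_integral_setT => [w _|w|w wB] //; rewrite lee_fin//.
    exact: pw.
have iter (f : Cd * Cd -> R) : (forall x, 0 <= f x) -> measurable_fun setT f ->
    (\int[mu]_z \int[mu]_w (f (z, w))%:E = \int[mu \x mu]_x (f x)%:E)%E.
  move=> f0 mf; rewrite (fubini_tonelli1 (fun x => (f x)%:E))//.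
  exact/measurable_EFinP.
have mE (f : Cd * Cd -> R) : measurable_fun setT f ->
    measurable_fun setT (fun x => (f x)%:E).
  by move=> mf; exact/measurable_EFinP.
rewrite (iter (fun x => k * c * e * (h1 x + h2 x + h3 x))); last 2 first.
- by move=> x; rewrite mulr_ge0// !addr_ge0.
- apply: measurable_funM => //; apply: measurable_funD => //.
  exact: measurable_funD.
under eq_integral do rewrite EFinM 2!EFinD.
rewrite ge0_integralZl//; last 2 first.
- by apply: emeasurable_funD; [apply: emeasurable_funD|]; exact: mE.
- by move=> x _; rewrite !adde_ge0// lee_fin.
rewrite ge0_integralD//; last 4 first.
- by move=> x _; rewrite adde_ge0// lee_fin.
- by apply: emeasurable_funD; exact: mE.
- by move=> x _; rewrite lee_fin.
- exact: mE.
rewrite ge0_integralD//; last 4 first.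
- by move=> x _; rewrite lee_fin.
- exact: mE.
- by move=> x _; rewrite lee_fin.
- exact: mE.
rewrite [leRHS](_ : _ = ((k * c * e)%:E * (4%:E + (K2 * 2)%:E + (K3 * 2)%:E))%E); last first.
  by rewrite -!EFinD -EFinM; congr EFin; ring.
apply: lee_wpmul2l => //.
apply: leeD; first apply: leeD.
- rewrite -iter//.
  have ig0 z : 0 <= indB z * gam z by rewrite mulr_ge0 ?indB_ge0.
  have mig : measurable_fun setT (fun z : Cd => (indB z * gam z)%:E).
    apply/measurable_EFinP; apply: measurable_funM => //; exact: measurable_indB.
  apply: (@le_trans _ _ (\int[mu]_z (2%:E * (indB z * gam z)%:E))%E).
    apply: ge0_le_integral_nonmeas => z _.
      by apply: integral_ge0 => w _; rewrite lee_fin.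
    rewrite /h1 /=; under eq_integral do rewrite EFinM.
    rewrite ge0_integralZl//; last 3 first.
    + apply/measurable_EFinP; apply: measurable_funM => //; exact: measurable_indB.
    + by move=> w _; rewrite lee_fin mulr_ge0 ?indB_ge0.
    + by rewrite lee_fin.
    by rewrite integral_indB muleC; apply: lee_wpmul2r; rewrite ?lee_fin.
  rewrite ge0_integralZl//; last by move=> z _; rewrite lee_fin.
  rewrite integral_indB (_ : 4 = 2 * 2); last by ring.
  by rewrite EFinM; apply: lee_wpmul2l.
(* In [h2] the function sits on the variable [w], so [z] is integrated first. *)
- rewrite (fubini_tonelli2 (fun x => (h2 x)%:E))//; last exact: mE.
  exact: H2.
- by rewrite -iter//; exact: H3.
Qed.

End bilinear_bound.

(** * Moduli of complex integrals *)

Section complex_integral.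
Set Implicit Arguments.
Unset Strict Implicit.
Context d (T : measurableType d) (R : realType).
Variable mu : {measure set T -> \bar R}.

Lemma normr_Rintegral_le (D : set T) (u : T -> R) (m : T -> \bar R) :
  (forall x, D x -> (`|u x|%:E <= m x)%E) ->
  (`|Rintegral mu D u|%:E <= \int[mu]_(x in D) m x)%E.
Proof.
move=> um; rewrite /Rintegral integralE.
have pm : (\int[mu]_(x in D) ((EFin \o u) ^\+ x) <= \int[mu]_(x in D) m x)%E.
  apply: ge0_le_integral_nonmeas => // x Dx; apply: le_trans (um x Dx).
  by rewrite funeposE /= -EFin_max lee_fin ge_max ler_norm normr_ge0.
have nm : (\int[mu]_(x in D) ((EFin \o u) ^\- x) <= \int[mu]_(x in D) m x)%E.
  apply: ge0_le_integral_nonmeas => // x Dx; apply: le_trans (um x Dx).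
  by rewrite funenegE /= -EFin_max lee_fin ge_max -normrN ler_norm normr_ge0.
have p0 : (0 <= \int[mu]_(x in D) ((EFin \o u) ^\+ x))%E by exact: integral_ge0.
have n0 : (0 <= \int[mu]_(x in D) ((EFin \o u) ^\- x))%E by exact: integral_ge0.
rewrite /= in pm nm p0 n0 *.
(* If the integral of [m] is infinite the bound is trivial. Otherwise both parts are finite, [fine]
   loses nothing, and the difference of two numbers of [[0, M]] lies in [[-M, M]]. *)
move: (integral _ _ _) (integral _ _ _) (integral _ _ _) pm nm p0 n0.
move=> [a| |] [b| |] [c| |]; rewrite ?leey ?lee_fin//=; rewrite ?lee_fin.
- by move=> ? ? ? ?; rewrite ler_norml; apply/andP; split; lra.
Qed.

(** The loss from real and imaginary parts stays a sum of two integrals: for the outer integral [m]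
    is itself an integral, and merging the two would call for its measurability. *)
Lemma normc_Cintegral_le (D : set T) (h : T -> R[i]) (m : T -> \bar R) :
  (forall x, D x -> ((normc (h x))%:E <= m x)%E) ->
  ((normc (Cintegral mu D h))%:E <=
   \int[mu]_(x in D) m x + \int[mu]_(x in D) m x)%E.
Proof.
move=> hm; apply: (@le_trans _ _
  (`|part true (Cintegral mu D h)| + `|part false (Cintegral mu D h)|)%:E).
  by rewrite lee_fin; exact: normc_le_part.
rewrite EFinD; apply: leeD; apply: normr_Rintegral_le => x Dx;
  apply: le_trans (hm x Dx); rewrite lee_fin.
  exact: (norm_part_le true).
exact: (norm_part_le false).
Qed.

Lemma normc_Cintegral_le_double (D : set T) (h : T -> R[i]) (m : T -> R) :
  measurable D -> measurable_fun D m -> (forall x, D x -> normc (h x) <= m x) ->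
  ((normc (Cintegral mu D h))%:E <= \int[mu]_(x in D) (2 * m x)%:E)%E.
Proof.
move=> mD mm hm.
have m0 x : D x -> (0 <= (m x)%:E)%E.
  by move=> Dx; rewrite lee_fin; apply: le_trans (hm x Dx); exact: normc_ge0.
apply: le_trans (normc_Cintegral_le (m := fun x => (m x)%:E) _) _ => //.
rewrite -ge0_integralD//; last 2 first.
- exact/measurable_EFinP.
- exact/measurable_EFinP.
apply: ge0_le_integral_nonmeas => x Dx; first by rewrite adde_ge0 ?m0.
by rewrite -EFinD lee_fin mulr_natl mulr2n.
Qed.

End complex_integral.

(** * Normalization, choice of exponents and passage to the limit *)

Section normalization.
Set Implicit Arguments.
Unset Strict Implicit.
Variables (R : realType) (d : nat).
Local Notation ball := (unit_ball R d).
Local Notation mu := (ball_measure R d).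

(** For the exponent [p] the integral is at most 1. The inequality [a]^ q <= 1 + a [^ p] and the
    total mass 1 then give 2. Dividing by a positive [c], not by the norm, also covers a zero
    norm. *)
Lemma Lp_normalized_le (p q c : R) (f : d.-tuple R[i] -> R[i]) :
  0 < q -> q <= p -> mem_Lp p f -> 0 < c -> fine (Lp_norm p f) <= c ->
  (\int[mu]_(w in ball) ((normc (f w) / c) `^ q)%:E <= 2%:E)%E.
Proof.
move=> q0 qp [mf fp] c0; have p0 : 0 < p := lt_le_trans q0 qp.
have mB := @measurable_unit_ball R d.
have mnf : measurable_fun ball (fun w => normc (f w)).
  exact: (measurableT_comp (@measurable_normc R)).
have mpow r (h : d.-tuple R[i] -> R) : measurable_fun ball h ->
    measurable_fun ball (fun w => (h w `^ r)%:E).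
  move=> mh; apply/measurable_EFinP.
  exact: (measurableT_comp (measurable_powR r)).
rewrite Lp_normE// in fp *.
set I := (\int[mu]_(w in ball) _)%E in fp *.
have I0 : (0 <= I)%E by apply: integral_ge0 => w _; rewrite lee_fin powR_ge0.
have pn0 : p != 0 by rewrite gt_eqF.
have pV0 : p^-1 != 0 by rewrite invr_eq0.
have [J J0 IE] : exists2 J, 0 <= J & I = J%:E.
  case: (I) I0 fp => [J|//|//]; first by exists J.
  by rewrite poweRyr// ltxx.
rewrite IE poweR_EFin /= => Jc.
have Ip : (\int[mu]_(w in ball) ((normc (f w) / c) `^ p)%:E <= 1)%E.
  under eq_integral do rewrite powRM ?normc_ge0 ?invr_ge0 ?(ltW c0)// EFinM.
  rewrite ge0_integralZr//; last 3 first.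
  - exact: mpow.
  - by move=> w _; rewrite lee_fin powR_ge0.
  - by rewrite lee_fin powR_ge0.
  rewrite -/I IE -EFinM lee_fin -[c^-1]powR_inv1 ?(ltW c0)// -powRrM mulN1r powRN.
  rewrite ler_pdivrMr ?powR_gt0// mul1r.
  rewrite -[leLHS]powRr1// -(mulVf pn0) powRrM.
  by apply: ge0_ler_powR; rewrite ?nnegrE ?powR_ge0// ltW.
apply: (@le_trans _ _ (\int[mu]_(w in ball) (1 + ((normc (f w) / c) `^ p)%:E))%E).
  apply: ge0_le_integral_nonmeas => w _; first by rewrite lee_fin powR_ge0.
  rewrite -EFinD lee_fin; apply: ler_powR_1D; rewrite ?(ltW q0)//.
  by rewrite divr_ge0 ?normc_ge0// ltW.
rewrite ge0_integralD//; last 2 first.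
- by move=> w _; rewrite lee_fin powR_ge0.
- by apply: mpow; apply: measurable_funM.
rewrite integral_cst// mul1e.
rewrite (_ : 2%:E = 1 + 1 :> \bar R)%E//; apply: leeD => //.
exact: probability_le1.
Qed.

(** If [1/p + 1/s >= 1], take [P = 1 - 1/p] and [S = 1 - 1/s]; the hypothesis on the exponents then
    reads [alpha / D <= P + S]. Otherwise [p] is lowered to the conjugate exponent of [s], so that
    [P + S = 1] and [alpha <= D] suffices. *)
Lemma critical_exponents (D p s alpha : R) : 0 < D -> 1 < p -> 1 < s ->
  alpha <= D -> s^-1 + p^-1 + alpha / D <= 2 ->
  exists P S, [/\ 0 < P, 0 < S, P + S <= 1, (1 - P)^-1 <= p &
                  (1 - S)^-1 = s /\ alpha <= D * (P + S)].
Proof.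
move=> D0 p1 s1 aD h.
have p0 : 0 < p by lra.
have s0 : 0 < s by lra.
have pV0 : 0 < p^-1 by rewrite invr_gt0.
have sV0 : 0 < s^-1 by rewrite invr_gt0.
have pV1 : p^-1 < 1 by rewrite invf_lt1.
have sV1 : s^-1 < 1 by rewrite invf_lt1.
have S1 : (1 - (1 - s^-1))^-1 = s by rewrite opprB addrC subrK invrK.
have [ps|ps] := leP 1 (p^-1 + s^-1).
  exists (1 - p^-1), (1 - s^-1); split; try lra.
    by rewrite opprB addrC subrK invrK.
  split=> //; rewrite mulrC -ler_pdivrMr//; lra.
exists (s^-1), (1 - s^-1); split => //; try lra.
  rewrite -[leRHS]invrK lef_pV2 ?posrE ?subr_gt0//; lra.
Qed.

Lemma ler_mul_limit (X K A E : R) : 0 < K -> 0 <= A -> 0 <= E ->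
  (forall c e, A < c -> E < e -> X <= K * c * e) -> X <= K * A * E.
Proof.
move=> K0 A0 E0 XK; rewrite leNgt; apply/negP => lt.
pose eta := X - K * A * E.
have eta0 : 0 < eta by rewrite subr_gt0.
(* As [h <= 1], replacing [A] and [E] by [A + h] and [E + h] raises [K * A * E] by at most
   [K * h * (A + E + 1)], that is by at most [eta / 2]. *)
pose h := Num.min 1 (eta / (2 * K * (A + E + 1))).
have B0 : 0 < A + E + 1 by lra.
have KB0 : 0 < 2 * K * (A + E + 1) by rewrite !mulr_gt0.
have h0 : 0 < h by rewrite lt_min ltr01 divr_gt0.
have h1 : h <= 1 by rewrite ge_min lexx.
have h2 : h * (2 * K * (A + E + 1)) <= eta.
  by rewrite -ler_pdivlMr// ge_min lexx orbT.
have /XK : A < A + h by lra.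
have Eh : E < E + h by lra.
move=> /(_ _ Eh).
have : K * h * h <= K * h by rewrite ler_piMr// mulr_ge0// ltW.
by move: h2; rewrite /eta; nra.
Qed.

End normalization.

(** * Absolute convergence and the bound for complex-valued functions *)

Theorem mainTheorem4 (R : realType) (d : nat) (p s alpha : R) :
  (1 <= d)%N -> 1 < p -> 1 < s ->
  alpha <= d.+1%:R -> s^-1 + p^-1 + alpha / d.+1%:R <= 2 ->
  exists C : R, forall f g : d.-tuple R[i] -> R[i],
    mem_Lp p f -> mem_Lp s g ->
    ((\int[ball_measure R d]_(z in unit_ball R d) \int[ball_measure R d]_(w in unit_ball R d)
        (normc (f w * g z) / normc (1 - inner_Cn z w) `^ alpha)%:E) < +oo)%E /\
    ((normc (Cintegral (ball_measure R d) (unit_ball R d) (fun z =>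
               Cintegral (ball_measure R d) (unit_ball R d) (fun w =>
                 f w * g z / (normc (1 - inner_Cn z w) `^ alpha)%:C))))%:E
       <= C%:E * Lp_norm p f * Lp_norm s g)%E.
Proof.
case: d => [//|n] _ p1 s1 aD h.
have [P [S [P0 S0 PS pP [sS aPS]]]] := critical_exponents (ltr0Sn _ _) p1 s1 aD h.
have [K K0 HK] := bilinear_bound P0 S0 PS aPS.
(* Each of the two nested complex integrals costs a factor 2. *)
exists (4 * K) => f g fp gs.
pose B := unit_ball R n.+1; pose mu := ball_measure R n.+1.
have mB : measurable B := @measurable_unit_ball R n.+1.
pose F : n.+1.-tuple R[i] -> R := (fun w => normc (f w)) \_ B.
pose G : n.+1.-tuple R[i] -> R := (fun w => normc (g w)) \_ B.
have FE w : B w -> F w = normc (f w) by move=> Bw; rewrite /F patchE mem_set.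
have GE z : B z -> G z = normc (g z) by move=> Bz; rewrite /G patchE mem_set.
have mF : measurable_fun setT F.
  apply: (measurable_restrictT _ mB).1; apply: (measurableT_comp (@measurable_normc R)).
  by case: fp.
have mG : measurable_fun setT G.
  apply: (measurable_restrictT _ mB).1; apply: (measurableT_comp (@measurable_normc R)).
  by case: gs.
have F0 w : 0 <= F w by rewrite /F patchE; case: ifP => // _; exact: normc_ge0.
have G0 w : 0 <= G w by rewrite /G patchE; case: ifP => // _; exact: normc_ge0.
pose A := fine (Lp_norm p f); pose E := fine (Lp_norm s g).
have A0 : 0 <= A by apply: fine_ge0; rewrite Lp_normE ?poweR_ge0//; lra.
have E0 : 0 <= E by apply: fine_ge0; rewrite Lp_normE ?poweR_ge0//; lra.
have AE : Lp_norm p f = A%:E.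
  rewrite fineK// ge0_fin_numE; first by case: fp.
  by rewrite Lp_normE ?poweR_ge0//; lra.
have EE : Lp_norm s g = E%:E.
  rewrite fineK// ge0_fin_numE; first by case: gs.
  by rewrite Lp_normE ?poweR_ge0//; lra.
(* The scalar [t] is absorbed into [F] and [c], whose quotient is unchanged. It is 1 for the
   convergence and 2 for the bound, where it is the loss of the inner integral. *)
have bound (t c e : R) : 0 < t -> A < c -> E < e ->
    (\int[mu]_(z in B) \int[mu]_(w in B)
      (t * (F w * G z / rho z w `^ alpha))%:E <= (K * (t * c) * e)%:E)%E.
  move=> t0 Ac Ee.
  have c0 : 0 < c by exact: le_lt_trans Ac.
  have e0 : 0 < e by exact: le_lt_trans Ee.
  under eq_integral do under eq_integral do rewrite 2!mulrA.
  apply: (HK (fun w => t * F w)) => //.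
  - by move=> w; rewrite mulr_ge0// ltW.
  - exact: measurable_funM.
  - by rewrite mulr_gt0.
  - apply: le_trans (Lp_normalized_le _ pP fp c0 (ltW Ac)); last first.
      by rewrite invr_gt0; lra.
    apply: ge0_le_integral_nonmeas => w wB; rewrite lee_fin ?powR_ge0//.
    by rewrite invfM mulrACA divff ?gt_eqF// mul1r FE.
  - rewrite sS; apply: le_trans (Lp_normalized_le _ (lexx s) gs e0 (ltW Ee)); last lra.
    by apply: ge0_le_integral_nonmeas => w wB; rewrite lee_fin ?powR_ge0// GE.
have mE z w : B z -> B w -> normc (f w * g z) / normc (1 - inner_Cn z w) `^ alpha
    = F w * G z / rho z w `^ alpha by move=> zB wB; rewrite normcM FE// GE.
have m0 z w : 0 <= F w * G z / rho z w `^ alpha.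
  by rewrite divr_ge0 ?mulr_ge0 ?powR_ge0.
split.
  have A1 : A < A + 1 by lra.
  have E1 : E < E + 1 by lra.
  apply: le_lt_trans (ltry (K * (1 * (A + 1)) * (E + 1))).
  apply: le_trans (bound _ _ _ ltr01 A1 E1).
  apply: ge0_le_integral_nonmeas => z zB.
    by apply: integral_ge0 => w wB; rewrite lee_fin mE.
  by apply: ge0_le_integral_nonmeas => w wB; rewrite lee_fin mE// mul1r.
rewrite AE EE -!EFinM lee_fin.
(* [bound] holds only for [c] and [e] strictly above the norms, which may vanish; the norms
   themselves are reached in the limit. *)
apply: ler_mul_limit => //; first by rewrite mulr_gt0.
move=> c e Ac Ee; rewrite -lee_fin.
pose J z := (\int[mu]_(w in B) (2 * (F w * G z / rho z w `^ alpha))%:E)%E.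
apply: (@le_trans _ _ (\int[mu]_(z in B) J z + \int[mu]_(z in B) J z)%E); last first.
  rewrite (_ : 4 * K * c * e = K * (2 * c) * e + K * (2 * c) * e); last by ring.
  by rewrite EFinD; apply: leeD; exact: bound.
apply: normc_Cintegral_le => z zB.
apply: normc_Cintegral_le_double => // [|w wB].
  apply: measurable_funTS; apply: measurable_funM.
    exact: measurable_funM.
  rewrite (_ : (fun w => _) = fun w => rho z w `^ (- alpha)).
    exact: measurable_rho_powR.
  by apply/funext => w; rewrite powRN.
rewrite normcM normcV -mE// le_eqVlt; apply/orP; left; apply/eqP.
by congr (_ / _); rewrite /= expr0n addr0 sqrtr_sqr ger0_norm// powR_ge0.
Qed.
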